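(* The $\mathbb F$-algebra homomorphism $\psi:\Delta_q\to\hat H_q$ that sends $A\mapsto t_1t_0+(t_1t_0)^{-1}$, $B\mapsto t_3t_0+(t_3t_0)^{-1}$, $C\mapsto t_2t_0+(t_2t_0)^{-1}$ is injective.
   Context: Algebras are associative with multiplicative identity $1$. $\mathbb F$ is a field and $q\in\mathbb F$ is nonzero with $q^4\neq 1$. The universal Askey--Wilson algebra $\Delta_q$ is the $\mathbb F$-algebra defined by generators $A,B,C$ and the relations asserting that each of $$A+\frac{qBC-q^{-1}CB}{q^2-q^{-2}},\qquad B+\frac{qCA-q^{-1}AC}{q^2-q^{-2}},\qquad C+\frac{qAB-q^{-1}BA}{q^2-q^{-2}}$$ is central in $\Delta_q$. The universal DAHA of type $(C_1^\vee,C_1)$, denoted $\hat H_q$, is the $\mathbb F$-algebra defined by generators $t_i^{\pm1}$ ($i\in\{0,1,2,3\}$) and relations: (i) $t_it_i^{-1}=t_i^{-1}t_i=1$ for each $i$; (ii) $t_i+t_i^{-1}$ is central for each $i$; (iii) $t_0t_1t_2t_3=q^{-1}$. The homomorphism $\psi$ exists and is unique. *)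

(* Defs.v *)
From HB Require Import structures.
From mathcomp Require Import all_boot all_order all_algebra.
From mathcomp Require Import boolp.
From mathcomp.multinomials Require Import monalg.
From mathcomp Require Import ring.

Set Implicit Arguments.
Unset Strict Implicit.
Unset Printing Implicit Defensive.

Import GRing.Theory.
Local Open Scope ring_scope.
Local Open Scope quotient_scope.

(* Quotient of a possibly noncommutative algebra by the two-sided ideal       *)
(* generated by a set of relators.  algType requires 1 != 0, hence the field  *)
(* relators_proper.                                                           *)
Section IdealGen.
Variables (R : nzRingType) (S : R -> Prop).

Definition ideal_gen (x : R) : Prop :=
  exists s : seq (R * R * R), (forall u, u \in s -> S u.1.2) /\
    x = \sum_(u <- s) u.1.1 * u.1.2 * u.2.

Lemma ideal_gen_incl x : S x -> ideal_gen x.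
Proof.
move=> Sx; exists [:: (1, x, 1)]; split; first by move=> u /[!inE] /eqP ->.
by rewrite big_seq1 mul1r mulr1.
Qed.

Lemma ideal_gen0 : ideal_gen 0.
Proof. by exists [::]; rewrite big_nil. Qed.

Lemma ideal_genD x y : ideal_gen x -> ideal_gen y -> ideal_gen (x + y).
Proof.
move=> [s [Ss ->]] [t [St ->]]; exists (s ++ t); rewrite big_cat; split=> // u.
by rewrite mem_cat => /orP[/Ss|/St].
Qed.

Lemma ideal_genMl z x : ideal_gen x -> ideal_gen (z * x).
Proof.
move=> [s [Ss ->]]; exists [seq (z * u.1.1, u.1.2, u.2) | u <- s]; split.
  by move=> _ /mapP[u us ->]; exact: (Ss u us).
by rewrite big_map mulr_sumr; apply: eq_bigr => u _; rewrite !mulrA.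
Qed.

Lemma ideal_genMr z x : ideal_gen x -> ideal_gen (x * z).
Proof.
move=> [s [Ss ->]]; exists [seq (u.1.1, u.1.2, u.2 * z) | u <- s]; split.
  by move=> _ /mapP[u us ->]; exact: (Ss u us).
by rewrite big_map mulr_suml; apply: eq_bigr => u _; rewrite !mulrA.
Qed.

Lemma ideal_genN x : ideal_gen x -> ideal_gen (- x).
Proof. by rewrite -mulN1r; apply: ideal_genMl. Qed.

Lemma ideal_gen_ker (B : nzRingType) (f : {rmorphism R -> B}) :
  (forall x, S x -> f x = 0) -> forall x, ideal_gen x -> f x = 0.
Proof.
move=> fS x [s [Ss ->]]; rewrite rmorph_sum big_seq big1 // => u /Ss/fS fu.
by rewrite !rmorphM /= fu mulr0 mul0r.
Qed.

Lemma ideal_gen_proper (B : nzRingType) (f : {rmorphism R -> B}) :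
  (forall x, S x -> f x = 0) -> ~ ideal_gen 1.
Proof. by move=> /ideal_gen_ker fS /fS /eqP; rewrite rmorph1 oner_eq0. Qed.

End IdealGen.

Record relators (R : nzRingType) := Relators {
  relator_set :> R -> Prop;
  relators_proper : ~ ideal_gen relator_set 1
}.

Section QuotAlg.
Variables (F : fieldType) (A : algType F) (S : relators A).

Definition ideal_pred : {pred A} := fun x => `[< ideal_gen S x >].

Lemma ideal_predP x : reflect (ideal_gen S x) (x \in ideal_pred).
Proof. exact: asboolP. Qed.

Lemma ideal_pred_zmod_closed : zmod_closed ideal_pred.
Proof.
split=> [|x y /ideal_predP Ix /ideal_predP Iy]; apply/ideal_predP.
  exact: ideal_gen0.
exact/ideal_genD/ideal_genN.
Qed.

HB.instance Definition _ := GRing.isZmodClosed.Build A ideal_pred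
  ideal_pred_zmod_closed.

Definition quotAlg : Type := Quotient.quot ideal_pred.

HB.instance Definition _ := GRing.Zmodule.on quotAlg.

Definition qpi (x : A) : quotAlg := \pi_(Quotient.quot ideal_pred) x.

Lemma qpiP x y : qpi x = qpi y <-> ideal_gen S (x - y).
Proof.
split=> [/eqP|/ideal_predP Ixy]; last by apply/eqP; rewrite -Quotient.idealrBE.
by rewrite -Quotient.idealrBE => /ideal_predP.
Qed.

Lemma qpi_surj (u : quotAlg) : exists x, u = qpi x.
Proof. by exists (repr (u : Quotient.quot ideal_pred)); rewrite /qpi reprK. Qed.

Lemma qpiB : zmod_morphism qpi.
Proof. by move=> x y; rewrite /qpi !piE. Qed.

HB.instance Definition _ := GRing.isZmodMorphism.Build A quotAlg qpi qpiB.

Lemma qpi0 x : S x -> qpi x = 0.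
Proof.
move=> Sx; rewrite -(raddf0 qpi); apply/qpiP; rewrite subr0.
exact: ideal_gen_incl.
Qed.

Definition qrepr (u : quotAlg) : A := repr (u : Quotient.quot ideal_pred).

Lemma qreprK : cancel qrepr qpi.
Proof. by move=> u; rewrite /qpi /qrepr reprK. Qed.

Lemma qrepr_pi x : ideal_gen S (qrepr (qpi x) - x).
Proof. by apply/qpiP; rewrite qreprK. Qed.

(* Locked, to keep unification from unfolding products in the quotient.       *)
Fact qop_key : unit. Proof. by []. Qed.

Definition qmul : quotAlg -> quotAlg -> quotAlg :=
  locked_with qop_key (fun u v => qpi (qrepr u * qrepr v)).

Definition qscale : F -> quotAlg -> quotAlg :=
  locked_with qop_key (fun k u => qpi (k *: qrepr u)).

Lemma qmulE x y : qmul (qpi x) (qpi y) = qpi (x * y).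
Proof.
rewrite /qmul unlock; apply/qpiP; set x' := qrepr _; set y' := qrepr _.
have -> : x' * y' - x * y = (x' - x) * y' + x * (y' - y).
  by rewrite mulrBl mulrBr addrA subrK.
by apply: ideal_genD; [apply: ideal_genMr|apply: ideal_genMl]; apply: qrepr_pi.
Qed.

Lemma qscaleE k x : qscale k (qpi x) = qpi (k *: x).
Proof.
rewrite /qscale unlock; apply/qpiP; rewrite -scalerBr -[_ - _]mul1r scalerAl.
exact/ideal_genMl/qrepr_pi.
Qed.

Lemma qmulA : associative qmul.
Proof.
move=> u v w; rewrite -[u]qreprK -[v]qreprK -[w]qreprK.
by rewrite !qmulE mulrA.
Qed.

Lemma qmul1q : left_id (qpi 1) qmul.
Proof. by move=> u; rewrite -[u]qreprK qmulE mul1r. Qed.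

Lemma qmulq1 : right_id (qpi 1) qmul.
Proof. by move=> u; rewrite -[u]qreprK qmulE mulr1. Qed.

Lemma qmulDl : left_distributive qmul +%R.
Proof.
move=> u v w; rewrite -[u]qreprK -[v]qreprK -[w]qreprK.
by rewrite -raddfD !qmulE mulrDl raddfD.
Qed.

Lemma qmulDr : right_distributive qmul +%R.
Proof.
move=> u v w; rewrite -[u]qreprK -[v]qreprK -[w]qreprK.
by rewrite -raddfD !qmulE mulrDr raddfD.
Qed.

Lemma qpi1_neq0 : qpi 1 != 0.
Proof.
apply/eqP; rewrite -(raddf0 qpi) => /qpiP; rewrite subr0.
exact: relators_proper.
Qed.

HB.instance Definition _ := GRing.Zmodule_isNzRing.Build quotAlg
  qmulA qmul1q qmulq1 qmulDl qmulDr qpi1_neq0.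

Lemma qpi_monoid : monoid_morphism qpi.
Proof. by split=> [//|x y]; exact/esym/qmulE. Qed.

HB.instance Definition _ := GRing.isMonoidMorphism.Build A quotAlg qpi qpi_monoid.

Lemma qscaleA a b u : qscale a (qscale b u) = qscale (a * b) u.
Proof. by rewrite -[u]qreprK !qscaleE scalerA. Qed.

Lemma qscale1 : left_id 1 qscale.
Proof. by move=> u; rewrite -[u]qreprK qscaleE scale1r. Qed.

Lemma qscaleDr : right_distributive qscale +%R.
Proof.
move=> a u v; rewrite -[u]qreprK -[v]qreprK -raddfD !qscaleE.
by rewrite scalerDr raddfD.
Qed.

Lemma qscaleDl u : {morph qscale^~ u : a b / a + b}.
Proof.
by move=> a b; rewrite -[u]qreprK !qscaleE scalerDl raddfD.
Qed.

HB.instance Definition _ := GRing.Zmodule_isLmodule.Build F quotAlg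
  qscaleA qscale1 qscaleDr qscaleDl.

Lemma qpiZ : scalable qpi.
Proof. by move=> a x; exact/esym/qscaleE. Qed.

HB.instance Definition _ := GRing.isScalable.Build F A quotAlg *:%R qpi qpiZ.

Lemma qscaleAl (a : F) (u v : quotAlg) : a *: (u * v) = a *: u * v.
Proof.
rewrite -[u]qreprK -[v]qreprK.
by rewrite -rmorphM -!linearZ -rmorphM /= scalerAl.
Qed.

HB.instance Definition _ := GRing.Lmodule_isLalgebra.Build F quotAlg qscaleAl.

Lemma qscaleAr (a : F) (u v : quotAlg) : a *: (u * v) = u * (a *: v).
Proof.
rewrite -[u]qreprK -[v]qreprK.
by rewrite -rmorphM -!linearZ -rmorphM /= scalerAr.
Qed.

HB.instance Definition _ := GRing.Lalgebra_isAlgebra.Build F quotAlg qscaleAr.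

Section Lift.
Variables (B : algType F) (f : {lrmorphism A -> B}).
Hypothesis fS : forall x, S x -> f x = 0.

Definition quot_lift (u : quotAlg) : B := f (qrepr u).

Lemma quot_liftE x : quot_lift (qpi x) = f x.
Proof.
apply/eqP; rewrite -subr_eq0 -raddfB /=.
by rewrite (ideal_gen_ker fS (qrepr_pi x)).
Qed.

Fact quot_lift_lrmorphism :
  exists g : {lrmorphism quotAlg -> B}, forall x, g (qpi x) = f x.
Proof.
have gB : zmod_morphism quot_lift.
  move=> u v; rewrite -[u]qreprK -[v]qreprK -raddfB !quot_liftE.
  exact: raddfB.
have gM : monoid_morphism quot_lift.
  split=> [|u v]; first by rewrite -(rmorph1 qpi) quot_liftE rmorph1.
  by rewrite -[u]qreprK -[v]qreprK -rmorphM !quot_liftE rmorphM.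
have gZ : scalable quot_lift.
  by move=> a u; rewrite -[u]qreprK -linearZ !quot_liftE linearZ.
pose gb := GRing.isZmodMorphism.Build _ _ _ gB.
pose gm := GRing.isMonoidMorphism.Build _ _ _ gM.
pose gz := GRing.isScalable.Build _ _ _ _ _ gZ.
pose g : {lrmorphism quotAlg -> B} := HB.pack quot_lift gb gm gz.
by exists g => x; apply: quot_liftE.
Qed.

End Lift.
End QuotAlg.

Lemma malg_scaleAr (K : monomType) (F : fieldType) (k : F)
  (x y : {malg F[K]}) : k *: (x * y) = x * (k *: y).
Proof.
have kE z : k *: z = z * k%:MP.
  rewrite -mul_malgC !malgM_def fgmulUg fgmulgU; apply: eq_bigr => m _.
  by rewrite mul1m mulm1 mulrC.
by rewrite !kE mulrA.
Qed.

Section FreeAlg.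
Variables (F : fieldType) (I : choiceType).

Definition freeAlg : Type := {malg F[{fmonom I}]}.

HB.instance Definition _ := GRing.Lalgebra.on freeAlg.

Lemma freeAlg_scaleAr (k : F) (x y : freeAlg) : k *: (x * y) = x * (k *: y).
Proof. exact: malg_scaleAr. Qed.

HB.instance Definition _ := GRing.Lalgebra_isAlgebra.Build F freeAlg
  freeAlg_scaleAr.

Fact gen_key : unit. Proof. by []. Qed.

Definition gen : I -> freeAlg := locked_with gen_key (fun i => << fmu i >>).

Lemma genE i : gen i = << fmu i >>.
Proof. by rewrite /gen unlock. Qed.

Section Lift.
Variables (B : algType F) (h : I -> B).

Definition word_eval (m : {fmonom I}) : B := \prod_(i <- (m : seq I)) h i.

Lemma word_eval_mmorphism : mmorphism word_eval.
Proof.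
by split=> [x y|]; rewrite /word_eval ?fmM ?big_cat // fm1 big_nil.
Qed.

HB.instance Definition _ :=
  monalg.isMultiplicative.Build {fmonom I} B word_eval word_eval_mmorphism.

Definition free_eval : freeAlg -> B := mmap (in_alg B) word_eval.

Lemma free_evalB : zmod_morphism free_eval.
Proof. by move=> x y; rewrite /free_eval raddfB. Qed.

Lemma free_evalM : monoid_morphism free_eval.
Proof.
have [fM f1] : multiplicative free_eval; last by split.
apply: commr_mmap_is_multiplicative => x m m'.
by rewrite /GRing.comm /= mulr_algl mulr_algr.
Qed.

Lemma free_evalZ : scalable free_eval.
Proof. by move=> a x; rewrite /free_eval mmapZ /= mulr_algl. Qed.

HB.instance Definition _ := GRing.isZmodMorphism.Build freeAlg B free_eval
  free_evalB.
HB.instance Definition _ := GRing.isMonoidMorphism.Build freeAlg B free_eval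
  free_evalM.
HB.instance Definition _ := GRing.isScalable.Build F freeAlg B *:%R free_eval
  free_evalZ.

Lemma free_eval_gen i : free_eval (gen i) = h i.
Proof. by rewrite /free_eval genE mmapU /= scale1r mul1r /word_eval fmU big_seq1. Qed.

Fact free_lrmorphism :
  exists f : {lrmorphism freeAlg -> B}, forall i, f (gen i) = h i.
Proof. by exists free_eval; exact: free_eval_gen. Qed.

End Lift.

Lemma freeAlg_ind (P : freeAlg -> Prop) :
  (forall k, P (k%:A)) -> (forall x y, P x -> P y -> P (x + y)) ->
  (forall x y, P x -> P y -> P (x * y)) -> (forall i, P (gen i)) ->
  forall x, P x.
Proof.
move=> Pk PD PM Pg x.
have P0 : P 0 by rewrite -(scale0r 1).
rewrite (monalgE x); apply: big_ind => // m _.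
have -> : << x@_m *g m >> = (x@_m)%:A * << m >> :> freeAlg.
  by rewrite mulr_algl -mul_malgC malgM_def fgmulUU mulr1 mul1m.
apply: (PM) => //; case: m => s; elim: s => [|i s IHs].
  suff -> : << FMonom [::] >> = 1%:A :> freeAlg by apply: Pk.
  by rewrite scale1r; congr << _ >>; rewrite -fmoneE.
suff -> : << FMonom (i :: s) >> = gen i * << FMonom s >> :> freeAlg.
  exact: PM.
rewrite genE malgM_def fgmulUU mulr1; congr << _ >>.
by apply/val_inj; rewrite /= fmM fmU.
Qed.

End FreeAlg.

Definition central (R : nzRingType) (z : R) : Prop := forall x, z * x = x * z.

Definition commutator (R : nzRingType) (x y : R) : R := x * y - y * x.

Section Relations.
Variables (F : fieldType) (q : F).
Implicit Types A B : algType F.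

Definition aw_elt A (a b c : A) : A :=
  a + (q ^+ 2 - q ^- 2)^-1 *: (q *: (b * c) - q^-1 *: (c * b)).

(* "z is central" is imposed through the relators z x - x z, for every x.     *)
Inductive Delta_rel A (a b c : A) : A -> Prop :=
| Delta_rel_A x : Delta_rel a b c (commutator (aw_elt a b c) x)
| Delta_rel_B x : Delta_rel a b c (commutator (aw_elt b c a) x)
| Delta_rel_C x : Delta_rel a b c (commutator (aw_elt c a b) x).

(* sV i stands for the inverse of s i. *)
Inductive Hhat_rel A (s sV : 'I_4 -> A) : A -> Prop :=
| Hhat_rel_mulrV i : Hhat_rel s sV (s i * sV i - 1)
| Hhat_rel_mulVr i : Hhat_rel s sV (sV i * s i - 1)
| Hhat_rel_central i x : Hhat_rel s sV (commutator (s i + sV i) x)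
| Hhat_rel_prod : Hhat_rel s sV (s 0 * s 1 * s 2 * s 3 - q^-1%:A).

Lemma lrmorph_commutator A B (f : {lrmorphism A -> B}) x y :
  f (commutator x y) = commutator (f x) (f y).
Proof. by rewrite /commutator rmorphB !rmorphM. Qed.

Lemma commutator_eq0 A (x y : A) : GRing.comm x y -> commutator x y = 0.
Proof. by rewrite /commutator => ->; rewrite subrr. Qed.

Lemma lrmorph_aw_elt A B (f : {lrmorphism A -> B}) a b c :
  f (aw_elt a b c) = aw_elt (f a) (f b) (f c).
Proof. by rewrite /aw_elt linearD linearZ linearB !linearZ !rmorphM. Qed.

Lemma Delta_rel_ker A (a b c : A) B (f : {lrmorphism A -> B}) :
    (forall x, [/\ GRing.comm (aw_elt (f a) (f b) (f c)) (f x),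
                   GRing.comm (aw_elt (f b) (f c) (f a)) (f x)
                 & GRing.comm (aw_elt (f c) (f a) (f b)) (f x)]) ->
  forall x, Delta_rel a b c x -> f x = 0.
Proof.
move=> fC _ [] x; have [ha hb hc] := fC x;
  by rewrite lrmorph_commutator lrmorph_aw_elt commutator_eq0.
Qed.

Lemma Hhat_rel_ker A (s sV : 'I_4 -> A) B (f : {lrmorphism A -> B}) :
    (forall i, f (s i) * f (sV i) = 1) -> (forall i, f (sV i) * f (s i) = 1) ->
    (forall i, central (f (s i) + f (sV i))) ->
    f (s 0) * f (s 1) * f (s 2) * f (s 3) = q^-1%:A ->
  forall x, Hhat_rel s sV x -> f x = 0.
Proof.
move=> sK Ks sC sP _ [i|i|i x|].
- by rewrite raddfB /= rmorphM rmorph1 sK subrr.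
- by rewrite raddfB /= rmorphM rmorph1 Ks subrr.
- by rewrite lrmorph_commutator raddfD /= commutator_eq0 //; apply: sC.
by rewrite raddfB /= rmorph_alg 3!rmorphM sP subrr.
Qed.

End Relations.

Section Delta.
Variables (F : fieldType) (q : F).

Definition Delta_presentation : freeAlg F 'I_3 -> Prop :=
  Delta_rel q (gen F 0) (gen F 1) (gen F 2).

Fact Delta_proper : ~ ideal_gen Delta_presentation 1.
Proof.
have [f fg] := free_lrmorphism (fun _ : 'I_3 => 0 : F^o).
apply: (ideal_gen_proper (f := f)) => x; apply: Delta_rel_ker => y.
by split; exact: mulrC.
Qed.

(* The hypothesis q ^+ 4 != 1 is not needed to define Delta: when it fails,    *)
(* the denominator in aw_elt is 0 and so is its inverse.                       *)
Definition Delta : algType F := quotAlg (Relators Delta_proper).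

Definition Agen : Delta := qpi _ (gen F 0).
Definition Bgen : Delta := qpi _ (gen F 1).
Definition Cgen : Delta := qpi _ (gen F 2).

End Delta.

Section Hhat.
Variables (F : fieldType) (q : F).

(* The generator (i, false) is t_i and the generator (i, true) is t_i^-1.     *)
Definition Hhat_presentation : freeAlg F ('I_4 * bool)%type -> Prop :=
  Hhat_rel q (fun i => gen F (i, false)) (fun i => gen F (i, true)).

Hypothesis q_neq0 : q != 0.

Fact Hhat_proper : ~ ideal_gen Hhat_presentation 1.
Proof.
pose s (p : 'I_4 * bool) : F^o :=
  if p.1 == 0 then if p.2 then q else q^-1 else 1.
have [f fg] := free_lrmorphism s.
apply: (ideal_gen_proper (f := f)) => x; apply: Hhat_rel_ker => [i|i|i y|].
- by rewrite !fg /s /=; case: ifP; rewrite ?mulVf ?mulr1.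
- by rewrite !fg /s /=; case: ifP; rewrite ?mulfV ?mulr1.
- exact: mulrC.
- by rewrite !fg /s /= !mulr1 [RHS]mulr1.
Qed.

Definition Hhat : algType F := quotAlg (Relators Hhat_proper).

Definition tgen (i : 'I_4) : Hhat := qpi _ (gen F (i, false)).
Definition tVgen (i : 'I_4) : Hhat := qpi _ (gen F (i, true)).

End Hhat.

Section Identity.
Variables (F : fieldType).

(* Decides linear identities in an F-vector space by comparing coefficients.  *)
Inductive lexp :=
  LVar of nat | LAdd of lexp & lexp | LOpp of lexp | LScale of F & lexp.

Fixpoint leval (V : lmodType F) (e : seq V) (x : lexp) : V :=
  match x with
  | LVar n => e`_n
  | LAdd x y => leval e x + leval e y
  | LOpp x => - leval e x
  | LScale k x => k *: leval e x
  end.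

Fixpoint lcoef (x : lexp) (i : nat) : F :=
  match x with
  | LVar n => (n == i)%:R
  | LAdd x y => lcoef x i + lcoef y i
  | LOpp x => - lcoef x i
  | LScale k x => k * lcoef x i
  end.

Lemma leval_sum (V : lmodType F) (e : seq V) x :
  leval e x = \sum_(i < size e) lcoef x i *: e`_i.
Proof.
elim: x => [n|x IHx y IHy|x IHx|k x IHx] /=.
- have [lt_n|le_n] := ltnP n (size e); last first.
    rewrite nth_default // big1 // => i _.
    by rewrite gtn_eqF ?scale0r // (leq_trans (ltn_ord i)).
  rewrite (bigD1 (Ordinal lt_n)) //= eqxx scale1r big1 ?addr0 // => i.
  by rewrite -val_eqE /= eq_sym => /negPf ->; rewrite scale0r.
- by rewrite IHx IHy -big_split; apply: eq_bigr => i _; rewrite scalerDl.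
- by rewrite IHx -sumrN; apply: eq_bigr => i _; rewrite scaleNr.
- by rewrite IHx scaler_sumr; apply: eq_bigr => i _; rewrite scalerA.
Qed.

Lemma leval_eq (V : lmodType F) (e : seq V) x y :
  foldr (fun i P => lcoef x i = lcoef y i /\ P) True (iota 0 (size e)) ->
  leval e x = leval e y.
Proof.
move=> exy; rewrite !leval_sum; apply: eq_bigr => i _; congr (_ *: _).
have : val i \in iota 0 (size e) by rewrite mem_iota add0n ltn_ord.
elim: (iota _ _) exy => //= j s IHs [exy exys] /[!inE] /orP[/eqP->//|].
exact: IHs.
Qed.

End Identity.

Ltac lvars V e l :=
  lazymatch e with
  | ?x + ?y => let l := lvars V x l in lvars V y l
  | - ?x => lvars V x l
  | ?k *: ?x => lvars V x l
  | _ =>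
    let rec mem l' := lazymatch l' with
      | nil => constr:(@cons V e l) | e :: _ => l | _ :: ?r => mem r end
    in mem l
  end.

Ltac lindex e l :=
  lazymatch l with
  | e :: _ => constr:(0%N)
  | _ :: ?r => let n := lindex e r in constr:(S n)
  end.

Ltac lreify F e l :=
  lazymatch e with
  | ?x + ?y =>
    let x := lreify F x l in let y := lreify F y l in constr:(@LAdd F x y)
  | - ?x => let x := lreify F x l in constr:(@LOpp F x)
  | ?k *: ?x => let x := lreify F x l in constr:(@LScale F k x)
  | _ => let n := lindex e l in constr:(@LVar F n)
  end.

Ltac lin F :=
  lazymatch goal with
  | |- @eq ?V ?x ?y =>
    let l := lvars V x (@nil V) in
    let l := lvars V y l in
    let x' := lreify F x l in
    let y' := lreify F y l in
    apply: (leval_eq (e := l) (x := x') (y := y')); rewrite /=;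
    do ?[split]
  end.

(* Let a, b, c, d be invertible elements of an algebra, each with a central   *)
(* sum x + x^-1, such that a b c d = q^-1.  This computes the Askey-Wilson    *)
(* combination of b a, d a, c a and their inverses, in Terwilliger's form.    *)
Section AWIdentity.
Variables (F : fieldType) (q : F) (R : algType F).
Variables (a a' b b' c c' d d' : R).
Hypothesis q_neq0 : q != 0.
Hypotheses (aK : a * a' = 1) (Ka : a' * a = 1).
Hypothesis Kb : b' * b = 1.
Hypotheses (cK : c * c' = 1) (Kc : c' * c = 1).
Hypothesis dK : d * d' = 1.
Hypotheses (aC : central (a + a')) (bC : central (b + b')).
Hypotheses (cC : central (c + c')) (dC : central (d + d')).
Hypothesis abcd : a * b * c * d = q^-1%:A.

Let A := b * a + a' * b'.
Let B := d * a + a' * d'.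
Let C := c * a + a' * c'.

Lemma aw_d : d = q^-1 *: (c' * b' * a').
Proof.
have := congr1 (fun x => c' * b' * a' * x) abcd.
rewrite -scalerAr mulr1 => <-; rewrite !mulrA.
by rewrite -(mulrA _ a') Ka mulr1 -(mulrA _ b') Kb mulr1 Kc mul1r.
Qed.

Lemma aw_d' : d' = q *: (a * b * c).
Proof.
rewrite -[LHS](mul1r) -(scale1r 1) -(mulfV q_neq0) -scalerA -abcd.
by rewrite -scalerAl -(mulrA _ d) dK mulr1.
Qed.

Lemma aw_sym x x' : central (x + x') -> x * a + a' * x' = a * x + x' * a'.
Proof.
move=> xC; have h1 : x * a = a * x + a * x' - x' * a.
  by rewrite -mulrDr -xC mulrDl addrK.
have h2 : a' * x' = x' * a + x' * a' - a * x'.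
  by rewrite -mulrDr -aC mulrDl addrC addKr.
by rewrite h1 h2; lin F; ring.
Qed.

Lemma aw_comm x x' : central (x + x') ->
  GRing.comm a (x * a + a' * x').
Proof.
move=> xC; rewrite /GRing.comm {2}aw_sym // mulrDr mulrDl !mulrA aK mul1r.
by rewrite -[x' * a' * a]mulrA Ka mulr1.
Qed.

Lemma aw_identity :
  (q ^+ 2 - q ^- 2) *: A + (q *: (B * C) - q^-1 *: (C * B)) =
  (q - q^-1) *: ((b + b') * (q^-1 *: a + q *: a') + (c + c') * (d + d')).
Proof.
have dB : B = q^-1 *: (c' * b') + q *: (b * c).
  rewrite /B aw_d aw_d' -scalerAl -scalerAr; congr (_ *: _ + _ *: _).
    by rewrite -(mulrA _ a') Ka mulr1.
  by rewrite !mulrA Ka mul1r.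
set T3 := d + d'.
have T3E : T3 = q *: (b * c * a) + q^-1 *: (a' * c' * b').
  rewrite -[LHS]mul1r -Ka -mulrA -dC mulrA /T3 mulrDr mulrDl addrC.
  rewrite aw_d aw_d' -!scalerAr -!scalerAl !mulrA Ka mul1r.
  by rewrite -(mulrA _ a' a) Ka mulr1.
have acb : a' * c' * b' = q *: T3 - q ^+ 2 *: (b * c * a).
  by rewrite T3E; lin F; field.
have cba : c' * b' * a' = q *: T3 - q ^+ 2 *: (a * b * c).
  by rewrite /T3 aw_d aw_d'; lin F; field.
have abc : a * b * c = q^-1 *: T3 - q ^- 2 *: (c' * b' * a').
  by rewrite cba; lin F; field.
have bca : b * c * a = q^-1 *: T3 - q ^- 2 *: (a' * c' * b').
  by rewrite acb; lin F; field.
set T2 := c + c'.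
have mid (z z' x y : R) : central (z + z') ->
    x * z * y + x * z' * y = (z + z') * (x * y).
  by move=> zC; rewrite mulrA zC mulrDr mulrDl.
have e1 : b * c * (c * a) = T2 * (b * c * a) - b * a.
  rewrite -(mulrA b c a) -(mid c c' b (c * a) cC).
  by rewrite -[b * c' * _]mulrA (mulrA c') Kc mul1r addrK.
have e8 : a' * c' * (c' * b') = T2 * (a' * c' * b') - a' * b'.
  rewrite -(mulrA a' c' b') -(mid c c' a' (c' * b') cC) addrC.
  by rewrite -[a' * c * _]mulrA (mulrA c) cK mul1r addKr.
have e4 : c' * b' * (a' * c') = q *: (T3 * c') - q ^+ 2 *: (a * b).
  by rewrite mulrA cba mulrBl -!scalerAl -(mulrA _ c) cK mulr1.
have e5 : c * a * (b * c) = q^-1 *: (T3 * c) - q ^- 2 *: (b' * a').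
  rewrite -mulrA [a * _]mulrA abc mulrBr -!scalerAr -dC.
  by rewrite -(mulrA c') (mulrA c) cK mul1r.
have e2 : b * c * (a' * c') = b * a + b * a' - b * c * a * c'.
  have -> : b * a + b * a' = b * c * a * c' + b * c * a' * c'.
    by rewrite (mid a a' (b * c) c' aC) -(mulrA b c) cK mulr1 -mulrDr aC.
  by rewrite mulrA; lin F; ring.
have e2' : b * c * a * c' = q^-1 *: (T3 * c') - q ^- 2 *: (a' * c' * b' * c').
  by rewrite bca mulrBl -!scalerAl.
have e6 : a' * c' * (b * c) =
    b * a' + b' * a' - T2 * (a' * c' * b') + a' * c' * b' * c'.
  have -> : T2 * (a' * c' * b') = a' * c' * b' * c + a' * c' * b' * c'.
    by rewrite cC mulrDr.
  have -> : b * a' + b' * a' = a' * c' * b * c + a' * c' * b' * c.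
    by rewrite (mid b b' (a' * c') c bC) -(mulrA a') Kc mulr1 mulrDl.
  by rewrite mulrA; lin F; ring.
have e3 : c' * b' * (c * a) =
    a * b + a * b' - T2 * (b * c * a) + c * (b * c * a).
  have -> : T2 * (b * c * a) = c * (b * c * a) + c' * (b * c * a).
    exact: mulrDl.
  have -> : a * b + a * b' = c' * (b * c * a) + c' * b' * (c * a).
    rewrite -[b * c * a]mulrA [c' * (_ * _)]mulrA (mid b b' c' (c * a) bC).
    by rewrite (mulrA c' c a) Kc mul1r bC mulrDr.
  by lin F; ring.
have e7 : c * a * (c' * b') =
    a * b' + a' * b' - q *: (T3 * c) + q ^+ 2 *: (c * (b * c * a)).
  have -> : T3 * c = q *: (c * (b * c * a)) + q^-1 *: (c * (a' * c' * b')).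
    by rewrite dC -/T3 T3E mulrDr -!scalerAr.
  have -> : a * b' + a' * b' = c * a * (c' * b') + c * (a' * c' * b').
    rewrite -[a' * c' * b']mulrA (mulrA c a') (mid a a' c (c' * b') aC).
    by rewrite (mulrA c c' b') cK mul1r mulrDl.
  by lin F; field.
have -> : A = a * b + b' * a' by rewrite /A aw_sym.
have -> : (b + b') * (q^-1 *: a + q *: a') =
    q^-1 *: (a * b + a * b') + q *: (b * a' + b' * a').
  by rewrite mulrDr -!scalerAr bC mulrDr mulrDl.
have -> : T2 * T3 = q *: (T2 * (b * c * a)) + q^-1 *: (T2 * (a' * c' * b')).
  by rewrite T3E mulrDr -!scalerAr.
have -> : B * C = q^-1 *: (c' * b' * (c * a)) + q^-1 *: (c' * b' * (a' * c'))
    + q *: (b * c * (c * a)) + q *: (b * c * (a' * c')).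
  by rewrite dB /C !mulrDl !mulrDr -!scalerAl !addrA.
have -> : C * B = q^-1 *: (c * a * (c' * b')) + q *: (c * a * (b * c))
    + q^-1 *: (a' * c' * (c' * b')) + q *: (a' * c' * (b * c)).
  by rewrite dB /C !mulrDl !mulrDr -!scalerAr !addrA.
rewrite e1 e2 e3 e4 e5 e6 e7 e8 e2'.
by lin F; field.
Qed.
End AWIdentity.

Section AWCommute.
Variables (F : fieldType) (q : F) (R : algType F).
Hypotheses (q_neq0 : q != 0) (q4_neq1 : q ^+ 4 != 1).

Lemma aw_den_neq0 : q ^+ 2 - q ^- 2 != 0.
Proof.
rewrite subr_eq0; apply: contra q4_neq1 => /eqP q2.
by rewrite (exprD q 2 2) {2}q2 mulfV // expf_neq0.
Qed.

Lemma aw_elt_comm (a a' b b' c c' d d' y : R) :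
    a * a' = 1 -> a' * a = 1 -> b' * b = 1 ->
    c * c' = 1 -> c' * c = 1 -> d * d' = 1 ->
    central (a + a') -> central (b + b') ->
    central (c + c') -> central (d + d') ->
    a * b * c * d = q^-1%:A -> GRing.comm a y ->
  GRing.comm
    (aw_elt q (b * a + a' * b') (d * a + a' * d') (c * a + a' * c')) y.
Proof.
move=> aK Ka Kb cK Kc dK aC bC cC dC abcd ay.
have a'y : GRing.comm a' y.
  by rewrite /GRing.comm -[a' * y]mulr1 -aK mulrA -(mulrA a') -ay mulrA Ka mul1r.
have := aw_identity q_neq0 Ka Kb cK Kc dK aC bC cC dC abcd.
move=> /(congr1 (fun x => (q ^+ 2 - q ^- 2)^-1 *: x)).
rewrite scalerDr scalerA mulVf ?aw_den_neq0 // scale1r /aw_elt => ->.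
have CZ k x : GRing.comm x y -> GRing.comm (k *: x) y.
  by rewrite /GRing.comm -scalerAl -scalerAr => ->.
have CD x z : GRing.comm x y -> GRing.comm z y -> GRing.comm (x + z) y.
  by rewrite /GRing.comm mulrDl mulrDr => -> ->.
have CM x z : GRing.comm x y -> GRing.comm z y -> GRing.comm (x * z) y.
  by rewrite /GRing.comm -mulrA => xy ->; rewrite mulrA xy mulrA.
by do 2!apply: (CZ); apply: (CD); apply: (CM); do ?[exact: bC|exact: cC|exact: dC];
  apply: (CD); apply: (CZ).
Qed.

Variables t tV : 'I_4 -> R.
Hypotheses (tK : forall i, t i * tV i = 1) (Kt : forall i, tV i * t i = 1).
Hypothesis tC : forall i, central (t i + tV i).
Hypothesis tP : t 0 * t 1 * t 2 * t 3 = q^-1%:A.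

Let A := t 1 * t 0 + tV 0 * tV 1.
Let B := t 3 * t 0 + tV 0 * tV 3.
Let C := t 2 * t 0 + tV 0 * tV 2.

Lemma t0_comm i : GRing.comm (t 0) (t i * t 0 + tV 0 * tV i).
Proof. exact: aw_comm. Qed.

Let u i := tV 0 * t i * t 0.
Let uV i := tV 0 * tV i * t 0.

Let uK i : u i * uV i = 1.
Proof.
rewrite /u /uV -!mulrA (mulrA (t 0)) tK mul1r (mulrA (t i)) tK mul1r.
by rewrite Kt.
Qed.

Let Ku i : uV i * u i = 1.
Proof.
rewrite /u /uV -!mulrA (mulrA (t 0)) tK mul1r (mulrA (tV i)) Kt mul1r.
by rewrite Kt.
Qed.

Let uE i : u i + uV i = t i + tV i.
Proof. by rewrite /u /uV -mulrDl -mulrDr -mulrA tC mulrA Kt mul1r. Qed.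

Let uC i : central (u i + uV i).
Proof. by rewrite uE; exact: tC. Qed.

Let u_conj i : u i * t 0 + tV 0 * uV i = t i * t 0 + tV 0 * tV i.
Proof.
have -> : u i * t 0 + tV 0 * uV i = tV 0 * (t i * t 0 + tV 0 * tV i) * t 0.
  by rewrite mulrDr mulrDl /u /uV !mulrA.
by rewrite -mulrA -t0_comm mulrA Kt mul1r.
Qed.

Lemma awA_comm y : GRing.comm (t 0) y -> GRing.comm (aw_elt q A B C) y.
Proof. by apply: (aw_elt_comm (b := t 1) (c := t 2) (d := t 3)). Qed.

Lemma awB_comm y : GRing.comm (t 0) y -> GRing.comm (aw_elt q B C A) y.
Proof.
rewrite /B -(u_conj 3).
apply: (aw_elt_comm (b := u 3) (c := t 1) (d := t 2)) => //.
rewrite /u !mulrA tK mul1r.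
have e : t 0 * t 1 * t 2 = q^-1 *: tV 3.
  by rewrite -[LHS]mulr1 -(tK 3) mulrA tP -scalerAl mul1r.
by rewrite -!mulrA (mulrA (t 0)) e -scalerAr tK.
Qed.

Lemma awC_comm y : GRing.comm (t 0) y -> GRing.comm (aw_elt q C A B) y.
Proof.
rewrite /C -(u_conj 2) /B -(u_conj 3).
apply: (aw_elt_comm (b := u 2) (c := u 3) (d := t 1)) => //.
rewrite /u !mulrA tK mul1r.
rewrite -[t 2 * t 0 * tV 0]mulrA tK mulr1.
have e : t 0 * t 1 = q^-1 *: (tV 3 * tV 2).
  have <- : t 0 * t 1 * t 2 * t 3 * (tV 3 * tV 2) = t 0 * t 1.
    by rewrite !mulrA -(mulrA _ (t 3)) tK mulr1 -(mulrA _ (t 2)) tK mulr1.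
  by rewrite tP -scalerAl mul1r.
by rewrite -mulrA e -scalerAr !mulrA -(mulrA (t 2)) tK mulr1 tK.
Qed.

End AWCommute.

Section Relation.
Variables (F : fieldType) (q : F).
Implicit Types A B : algType F.

Lemma Hhat_rel_hold A (s sV : 'I_4 -> A) B (f : {lrmorphism A -> B}) :
    (forall y, exists x, y = f x) -> (forall x, Hhat_rel q s sV x -> f x = 0) ->
  [/\ forall i, f (s i) * f (sV i) = 1, forall i, f (sV i) * f (s i) = 1,
      forall i, central (f (s i) + f (sV i))
    & f (s 0) * f (s 1) * f (s 2) * f (s 3) = q^-1%:A].
Proof.
move=> f_surj f0; split=> [i|i|i y|]; apply/eqP; rewrite -subr_eq0.
- by rewrite -rmorphM -(rmorph1 f) -rmorphB; apply/eqP/f0; constructor.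
- by rewrite -rmorphM -(rmorph1 f) -rmorphB; apply/eqP/f0; constructor.
- have [x ->] := f_surj y; rewrite -raddfD.
  by rewrite -[_ - _]/(commutator _ _) -lrmorph_commutator; apply/eqP/f0; constructor.
by rewrite -!rmorphM -(rmorph_alg f) -rmorphB; apply/eqP/f0; constructor.
Qed.

Lemma mulr_pairK A (x x' y y' : A) :
  x * x' = 1 -> y * y' = 1 -> (x * y) * (y' * x') = 1.
Proof. by move=> xK yK; rewrite mulrA -(mulrA x) yK mulr1. Qed.

Lemma comm_gen (I : choiceType) B (f : {lrmorphism freeAlg F I -> B}) (z : B) :
  (forall i, GRing.comm z (f (gen F i))) -> forall x, GRing.comm z (f x).
Proof.
move=> zg; apply: freeAlg_ind => // [k|x y zx zy|x y zx zy].
- by rewrite rmorph_alg /GRing.comm mulr_algl mulr_algr.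
- by rewrite raddfD; apply: commrD.
- by rewrite rmorphM; apply: commrM.
Qed.

Lemma lrmorph_gen_eq (I : choiceType) B (f g : {lrmorphism freeAlg F I -> B}) :
  (forall i, f (gen F i) = g (gen F i)) -> f =1 g.
Proof.
move=> fg; apply: freeAlg_ind => // [k|x y fx fy|x y fx fy].
- by rewrite !rmorph_alg.
- by rewrite (rmorphD f) (rmorphD g); congr (_ + _).
- by rewrite (rmorphM f) (rmorphM g); congr (_ * _).
Qed.

End Relation.

Section Psi.
Variables (F : fieldType) (q : F) (q_neq0 : q != 0) (q4_neq1 : q ^+ 4 != 1).

Local Notation t := (tgen q_neq0).
Local Notation tV := (tVgen q_neq0).

Lemma Hhat_relations :
  [/\ forall i, t i * tV i = 1, forall i, tV i * t i = 1,
      forall i, central (t i + tV i) & t 0 * t 1 * t 2 * t 3 = q^-1%:A].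
Proof.
apply: (Hhat_rel_hold (f := qpi (Relators (Hhat_proper q_neq0)))).
  exact: qpi_surj.
by move=> x xR; apply: (qpi0 (S := Relators _)).
Qed.

(* The inverse of t i * t j in Hhat is tV j * tV i.                           *)
Lemma tt_mulrV i j : (t i * t j) * (tV j * tV i) = 1.
Proof. by have [tK _ _ _] := Hhat_relations; apply: mulr_pairK. Qed.

Lemma tt_mulVr i j : (tV j * tV i) * (t i * t j) = 1.
Proof. by have [_ Kt _ _] := Hhat_relations; apply: mulr_pairK. Qed.

Lemma Delta_lift (B : algType F) (h : 'I_3 -> B) :
    (forall i, GRing.comm (aw_elt q (h 0) (h 1) (h 2)) (h i)) ->
    (forall i, GRing.comm (aw_elt q (h 1) (h 2) (h 0)) (h i)) ->
    (forall i, GRing.comm (aw_elt q (h 2) (h 0) (h 1)) (h i)) ->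
  exists f : {lrmorphism Delta q -> B},
    [/\ f (Agen q) = h 0, f (Bgen q) = h 1 & f (Cgen q) = h 2].
Proof.
move=> hA hB hC; have [f fg] := free_lrmorphism h.
have f0 x : Delta_presentation q x -> f x = 0.
  apply: Delta_rel_ker => y; rewrite !fg.
  by split; apply: comm_gen => i; rewrite fg.
have [g gE] := quot_lift_lrmorphism (S := Relators (Delta_proper (q := q))) f0.
by exists g; split; rewrite gE fg.
Qed.

Lemma Delta_hom_eq (B : algType F) (f g : {lrmorphism Delta q -> B}) :
    f (Agen q) = g (Agen q) -> f (Bgen q) = g (Bgen q) ->
    f (Cgen q) = g (Cgen q) -> f =1 g.
Proof.
move=> fgA fgB fgC u; have [x ->] := qpi_surj u.
pose p := qpi (Relators (Delta_proper (q := q))).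
have := lrmorph_gen_eq (f := f \o p) (g := g \o p) _ x; apply => i.
have /or3P[] : [|| i == 0, i == 1 | i == 2] by case: i => [[|[|[|]]]].
- by move/eqP->.
- by move/eqP->.
- by move/eqP->.
Qed.

(* Uniqueness of psi is Delta_hom_eq.                                         *)
Fact psi_exists : exists psi : {lrmorphism Delta q -> Hhat q_neq0},
  [/\ psi (Agen q) = t 1 * t 0 + tV 0 * tV 1,
      psi (Bgen q) = t 3 * t 0 + tV 0 * tV 3
    & psi (Cgen q) = t 2 * t 0 + tV 0 * tV 2].
Proof.
have [tK Kt tC tP] := Hhat_relations.
pose i3 (i : 'I_3) : 'I_4 := if i == 0 then 1 else if i == 1 then 3 else 2.
pose h i := t (i3 i) * t 0 + tV 0 * tV (i3 i).
have hC i : GRing.comm (t 0) (h i) by apply: t0_comm.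
by apply: (Delta_lift (h := h)) => i;
  [apply: awA_comm|apply: awB_comm|apply: awC_comm].
Qed.

End Psi.

(* Main.v *)
Require Import Defs.
From HB Require Import structures.
From mathcomp Require Import all_boot all_order all_algebra.
From mathcomp Require Import boolp.
From mathcomp Require Import ring zify.

Set Implicit Arguments.
Unset Strict Implicit.
Unset Printing Implicit Defensive.

Import Order.TTheory GRing.Theory Num.Theory.
Local Open Scope ring_scope.

(** Write alpha, beta, gamma for the three central combinations of A, B, C in
    Delta, multiplied by q + 1/q, and Omega for the Casimir element.  The proof
    compares a spanning set of Delta with its images in one family of
    Hhat-modules.

    Spanning set.  The defining relations make A, B, C commute up to powers of
    q and shorter words, and Omega rewrites A B C as a central element plus
    shorter words.  Hence every element of Delta is a combination of the
    monomials A^i B^j C^k Omega^l alpha^r beta^s gamma^t with i j k = 0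
    ([Delta_normal_form]).

    Modules.  In any Hhat-module on which every t_i + 1/t_i acts as a scalar,
    t_0 and t_1 preserve the sum of two eigenspaces of t_0 t_1 with inverse
    eigenvalues, and t_2 and t_3 the sum of two eigenspaces whose eigenvalues
    have product q^-2.  Starting from one eigenvalue a, these planes link up into
    a doubly infinite chain of eigenlines; a and the scalars t_i + 1/t_i
    determine the 2 x 2 blocks up to rescaling the lines, and the blocks so
    found define a module ([chain_rep]).  The only demand on a is that no
    a^2 q^(2n) equals 1, so q may be a root of unity.

    Action of A, B, C.  These commute with t_0, hence act on an eigenspace of
    t_0, which is a space of sequences indexed by the integers.  There A is
    diagonal, with entries lam + 1/lam for lam = a q^(-2m); B and C are
    tridiagonal, B raising the index with coefficient 1 and C with coefficient
    - q^(2m+1)/a; alpha, beta, gamma and Omega are scalars free of a, the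
    explicit polynomials [alpha_val], [beta_val], [gamma_val], [casimir_val].

    Independence.  Suppose a nontrivial combination of monomials is killed by
    psi, and apply it to a sequence supported at 0.  Its entry at the largest
    reachable index d only sees the monomials with j + k = d, each of which
    contributes [top_coef].  Specialize the parameters to powers of one variable
    X over F, so widely spaced that the order of the pole at X = 0 encodes the
    exponents.  The four central values have leading terms of the shape
    u T_1, u T_3, u T_2 and u^2, whose exponent vectors are independent, so
    (l, r, s, t) can be read off; for a as a power of X with an exponent of
    either sign, the order also records i + k or i - k.  For one of the two signs
    the term of largest order is unique ([top_order_unique]), so its coefficient
    vanishes, a contradiction. *)

(** * Linear identities in an algebra *)

Ltac same_term x y := match goal with |- _ => unify x y end.

Ltac lin_atoms V e l :=
  lazymatch e with
  | ?x + ?y => let l := lin_atoms V x l in lin_atoms V y l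
  | - ?x => lin_atoms V x l
  | ?k *: ?x => lin_atoms V x l
  | _ =>
    let rec mem l' := lazymatch l' with
      | nil => constr:(@cons V e l)
      | ?x :: ?r => match goal with
          | |- _ => let _ := same_term e x in l
          | |- _ => mem r
          end
      end in mem l
  end.

Ltac lin_index e l :=
  lazymatch l with
  | ?x :: ?r => match goal with
      | |- _ => let _ := same_term e x in constr:(0%N)
      | |- _ => let n := lin_index e r in constr:(S n)
      end
  end.

Ltac lin_reify F e l :=
  lazymatch e with
  | ?x + ?y => let x := lin_reify F x l in let y := lin_reify F y l in
               constr:(@LAdd F x y)
  | - ?x => let x := lin_reify F x l in constr:(@LOpp F x)
  | ?k *: ?x => let x := lin_reify F x l in constr:(@LScale F k x)
  | _ => let n := lin_index e l in constr:(@LVar F n)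
  end.

(** Same reflection as [lin], but atoms are identified up to conversion: the
    bimodule laws leave products formed in different, convertible structures on
    the same carrier. *)
Ltac linear_eq F :=
  lazymatch goal with
  | |- @eq ?V ?x ?y =>
    let l := lin_atoms V x (@nil V) in
    let l := lin_atoms V y l in
    let x' := lin_reify F x l in
    let y' := lin_reify F y l in
    apply: (leval_eq (e := l) (x := x') (y := y')); rewrite /=;
    do ?[split]
  end.

Ltac expand := rewrite ?(mulrDl, mulrDr, mulrBl, mulrBr, mulNr, mulrN, mulrA,
  =^~ scalerAl, =^~ scalerAr).

(** * The Casimir element *)

Section QNumbers.
Variables (F : fieldType) (q : F).
Hypotheses (q_neq0 : q != 0) (q4_neq1 : q ^+ 4 != 1).

Lemma q2_neq1 : q ^+ 2 != 1.
Proof. by apply: contra q4_neq1 => /eqP q2; rewrite (exprM q 2 2) q2 expr1n. Qed.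

Lemma qBV_neq0 : q - q^-1 != 0.
Proof.
apply: contra q2_neq1; rewrite subr_eq0 => /eqP h.
by rewrite expr2 {2}h mulfV.
Qed.
End QNumbers.

Section Casimir.
Variables (F : fieldType) (q : F) (R : algType F) (A B C : R).
Hypotheses (q_neq0 : q != 0) (q4_neq1 : q ^+ 4 != 1).

(** The factor q + 1/q is the usual normalization of alpha, beta, gamma: it
    turns their values under psi into polynomials with coefficients 1. *)
Definition aw_scaled (a b c : R) : R := (q + q^-1) *: aw_elt q a b c.
Definition casimir : R :=
  q *: (A * B * C) + q ^+ 2 *: (A * A) + q ^- 2 *: (B * B) + q ^+ 2 *: (C * C)
  - q *: (A * aw_scaled A B C) - q^-1 *: (B * aw_scaled B C A)
  - q *: (C * aw_scaled C A B).

Lemma aw_swap (a b c : R) :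
  c * b = q ^+ 2 *: (b * c) - (q ^+ 2 - 1) *: aw_scaled a b c
          + (q * (q ^+ 2 - q ^- 2)) *: a.
Proof.
have nz : q ^+ 4 - 1 != 0 by rewrite subr_eq0.
have nz2 : q ^+ 2 - q ^- 2 != 0 by exact: aw_den_neq0.
rewrite /aw_scaled /aw_elt; have nz' : (q * q) ^+ 2 - 1 != 0 by rewrite -expr2 -exprM.
by linear_eq F; field; rewrite ?q_neq0 ?nz'.
Qed.

Hypotheses (alC : central (aw_scaled A B C)) (beC : central (aw_scaled B C A))
  (gaC : central (aw_scaled C A B)).

(** Moving A leftwards through A B C, B B and C C produces correction terms
    that cancel against those of the three terms with alpha, beta, gamma. *)
Lemma casimir_commA : GRing.comm casimir A.
Proof.
have BA := aw_swap C A B; have CB := aw_swap A B C.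
have CA : C * A = q ^- 2 *: (A * C) + (1 - q ^- 2) *: aw_scaled B C A
                  - (q^-1 * (q ^+ 2 - q ^- 2)) *: B.
  by rewrite (aw_swap B C A); linear_eq F; field.
rewrite /GRing.comm /casimir.
move: alC beC gaC BA CB CA.
move: (aw_scaled A B C) (aw_scaled B C A) (aw_scaled C A B) => al be ga.
move=> al_c be_c ga_c BA CB CA.
have ABCA : A * B * C * A = A * A * B * C - (1 - q ^- 2) *: (A * C * ga)
    + (q^-1 * (q ^+ 2 - q ^- 2)) *: (A * C * C)
    + (1 - q ^- 2) *: (A * B * be) - (q^-1 * (q ^+ 2 - q ^- 2)) *: (A * B * B).
  rewrite -mulrA CA; expand; rewrite -[A * B * A]mulrA BA; expand.
  rewrite -[A * ga * C]mulrA ga_c; expand.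
  by linear_eq F; field.
have BBA : B * B * A = q ^+ 4 *: (A * B * B)
   - (q ^+ 4 - 1) *: (B * ga) + (q * (q ^+ 2 - q ^- 2)) *: (B * C + q ^+ 2 *: (C * B)).
  rewrite -mulrA BA; expand; rewrite BA; expand.
  by rewrite (ga_c B); linear_eq F; field.
have CCA : C * C * A = q ^- 4 *: (A * C * C)
   + (1 - q ^- 4) *: (C * be) - (q^-1 * (q ^+ 2 - q ^- 2)) *: (C * B + q ^- 2 *: (B * C)).
  rewrite -mulrA CA; expand; rewrite CA; expand.
  by rewrite (be_c C); linear_eq F; field.
expand; rewrite ABCA BBA CCA -!mulrA (al_c A) (be_c A) (ga_c A) !mulrA BA CA; expand.
rewrite (ga_c be) CB; expand.
by linear_eq F; field.
Qed.
End Casimir.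

Section CasimirCentral.
Variables (F : fieldType) (q : F) (R : algType F) (A B C : R).
Hypotheses (q_neq0 : q != 0) (q4_neq1 : q ^+ 4 != 1).
Hypotheses (alC : central (aw_scaled q A B C)) (beC : central (aw_scaled q B C A))
  (gaC : central (aw_scaled q C A B)).

(** Cyclic invariance reduces commutation with B and C to commutation with A. *)
Lemma casimir_cyclic : casimir q A B C = casimir q B C A.
Proof.
have BA := aw_swap q_neq0 q4_neq1 C A B; have CB := aw_swap q_neq0 q4_neq1 A B C.
have CA : C * A = q ^- 2 *: (A * C) + (1 - q ^- 2) *: aw_scaled q B C A
                  - (q^-1 * (q ^+ 2 - q ^- 2)) *: B.
  by rewrite (aw_swap q_neq0 q4_neq1 B C A); linear_eq F; field.
rewrite /casimir; move: alC beC gaC BA CB CA.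
move: (aw_scaled q A B C) (aw_scaled q B C A) (aw_scaled q C A B) => al be ga.
move=> al_c be_c ga_c BA CB CA.
rewrite -[B * C * A]mulrA CA; expand; rewrite BA; expand; rewrite (ga_c C).
by linear_eq F; field.
Qed.
End CasimirCentral.

(** * A spanning set *)

Section Spanning.
Variables (F : fieldType) (q : F) (R : algType F) (A B C : R).
Hypotheses (q_neq0 : q != 0) (q4_neq1 : q ^+ 4 != 1).
Hypotheses (alC : central (aw_scaled q A B C)) (beC : central (aw_scaled q B C A))
  (gaC : central (aw_scaled q C A B)).

Local Notation al := (aw_scaled q A B C).
Local Notation be := (aw_scaled q B C A).
Local Notation ga := (aw_scaled q C A B).
Local Notation Om := (casimir q A B C).

Lemma casimir_comm X : X \in [:: A; B; C] -> GRing.comm Om X.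
Proof.
have cyc := casimir_cyclic q_neq0 q4_neq1.
rewrite !inE => /or3P[] /eqP->; first exact: casimir_commA.
  by rewrite cyc //; apply: casimir_commA.
by rewrite cyc // cyc //; apply: casimir_commA.
Qed.

(** ((i, j, k), (l, r, s, t)): exponents of A, B, C, then of Omega, alpha, beta,
    gamma. *)
Definition exponents : Type := (nat * nat * nat) * (nat * nat * nat * nat).
Definition central_monomial (e : nat * nat * nat * nat) : R :=
  let: (l, r, s, t) := e in Om ^+ l * al ^+ r * be ^+ s * ga ^+ t.
Definition monomial (e : exponents) : R :=
  let: (i, j, k) := e.1 in A ^+ i * B ^+ j * C ^+ k * central_monomial e.2.

(** The filtration by word length in A, B, C, where central elements have
    length 0: this is what makes A B C reducible to length 2. *)
Inductive words : nat -> R -> Prop :=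
| words_one n : words n 1
| words_add n x y : words n x -> words n y -> words n (x + y)
| words_scale n c x : words n x -> words n (c *: x)
| words_central n z x : z \in [:: Om; al; be; ga] -> words n x -> words n (z * x)
| words_cons n X x : X \in [:: A; B; C] -> words n x -> words n.+1 (X * x).

Lemma words_leS n x : words n x -> words n.+1 x.
Proof. by elim=> *; by constructor. Qed.

Lemma words_le m n x : (m <= n)%N -> words m x -> words n x.
Proof.
move/subnKC<-; elim: (n - m)%N => [|d IHd]; rewrite ?addn0 ?addnS // => /IHd.
exact: words_leS.
Qed.

Lemma words_sub n x y : words n x -> words n y -> words n (x - y).
Proof. by move=> wx wy; rewrite -scaleN1r; apply/words_add/words_scale. Qed.

Lemma words0 n : words n 0.
Proof. by rewrite -(scale0r 1); apply/words_scale/words_one. Qed.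

Lemma words_mul m n x y : words m x -> words n y -> words (m + n) (x * y).
Proof.
move=> wx wy; elim: wx => {m x}
  [m|m x x' _ wx _ wx'|m c x _ wx|m z x zZ _ wx|m X x XG _ wx].
- by rewrite mul1r; apply: words_le wy; rewrite leq_addl.
- by rewrite mulrDl; apply: words_add.
- by rewrite -scalerAl; apply: words_scale.
- by rewrite -mulrA; apply: words_central.
- by rewrite -mulrA addSn; apply: words_cons.
Qed.

Lemma words1 X : X \in [:: A; B; C] -> words 1 X.
Proof. by move=> XG; rewrite -[X]mulr1; apply: words_cons => //; constructor. Qed.

Lemma words1_ABC : [/\ words 1 A, words 1 B & words 1 C].
Proof. by split; apply: words1; rewrite !inE eqxx ?orbT. Qed.

Lemma words_exp X n : X \in [:: A; B; C] -> words n (X ^+ n).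
Proof.
by move=> XG; elim: n => [|n IHn]; [constructor|rewrite exprS; apply: words_cons].
Qed.

Lemma words_central1 z : z \in [:: Om; al; be; ga] -> words 0 z.
Proof. by move=> zZ; rewrite -[z]mulr1; apply: words_central => //; constructor. Qed.

(** The relations read q b c - q^-1 c b = multiple of alpha - multiple of a. *)
Lemma words_swap X Y : X \in [:: A; B; C] -> Y \in [:: A; B; C] ->
  exists c, words 1 (X * Y - c *: (Y * X)).
Proof.
have wz z : z \in [:: Om; al; be; ga] -> words 1 z by move/words_central1/words_leS.
have H a b c : a \in [:: A; B; C] -> aw_scaled q a b c \in [:: Om; al; be; ga] ->
   (exists d, words 1 (c * b - d *: (b * c))) /\ exists d, words 1 (b * c - d *: (c * b)).
  move=> aG zZ; have cb := aw_swap q_neq0 q4_neq1 a b c; split.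
    exists (q ^+ 2); have -> : c * b - q ^+ 2 *: (b * c) =
        (q * (q ^+ 2 - q ^- 2)) *: a - (q ^+ 2 - 1) *: aw_scaled q a b c.
      by rewrite cb; linear_eq F; ring.
    by apply: words_sub; apply: words_scale; [apply: words1|apply: wz].
  exists (q ^- 2); have -> : b * c - q ^- 2 *: (c * b) =
      (1 - q ^- 2) *: aw_scaled q a b c - (q^-1 * (q ^+ 2 - q ^- 2)) *: a.
    by rewrite cb; linear_eq F; field.
  by apply: words_sub; apply: words_scale; [apply: wz|apply: words1].
have [||cb bc] := H A B C; rewrite ?inE ?eqxx ?orbT //.
have [||ac ca] := H B C A; rewrite ?inE ?eqxx ?orbT //.
have [||ba ab] := H C A B; rewrite ?inE ?eqxx ?orbT //.
have E X' : exists d, words 1 (X' * X' - d *: (X' * X')).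
  by exists 1; rewrite scale1r subrr; apply: words0.
by move=> /or3P[] /eqP-> /or3P[] /eqP->.
Qed.

Lemma words_swap_exp X Y n : X \in [:: A; B; C] -> Y \in [:: A; B; C] ->
  exists c, words n (X * Y ^+ n - c *: (Y ^+ n * X)).
Proof.
move=> XG YG; have [c wc] := words_swap XG YG.
elim: n => [|n [d wd]].
  by exists 1; rewrite expr0 mulr1 mul1r scale1r subrr; apply: words0.
exists (c * d).
have -> : X * Y ^+ n.+1 - (c * d) *: (Y ^+ n.+1 * X) =
   (X * Y - c *: (Y * X)) * Y ^+ n + c *: (Y * (X * Y ^+ n - d *: (Y ^+ n * X))).
  rewrite exprS mulrBl mulrBr scalerBr -!scalerAl -!scalerAr scalerA !mulrA.
  by rewrite addrA subrK.
apply: words_add; first by rewrite -[n.+1]add1n; apply: words_mul => //; exact: words_exp.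
by apply/words_scale/words_cons.
Qed.

Definition normal (e : exponents) : bool :=
  let: (i, j, k) := e.1 in [|| i == 0, j == 0 | k == 0]%N.
Definition degree (e : exponents) : nat := let: (i, j, k) := e.1 in (i + j + k)%N.

Definition normal_span (n : nat) (x : R) : Prop :=
  exists s : seq (F * exponents),
    (forall u, u \in s -> normal u.2 /\ (degree u.2 <= n)%N) /\
    x = \sum_(u <- s) u.1 *: monomial u.2.

Lemma normal_span_monomial n e : normal e -> (degree e <= n)%N ->
  normal_span n (monomial e).
Proof.
move=> ne de; exists [:: (1, e)]; rewrite big_seq1 scale1r; split=> // u.
by rewrite inE => /eqP->.
Qed.

Lemma normal_span_add n x y : normal_span n x -> normal_span n y ->
  normal_span n (x + y).
Proof.
move=> [s [Hs ->]] [t [Ht ->]]; exists (s ++ t); rewrite big_cat; split=> // u.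
by rewrite mem_cat => /orP[/Hs|/Ht].
Qed.

Lemma normal_span_scale n c x : normal_span n x -> normal_span n (c *: x).
Proof.
move=> [s [Hs ->]]; exists [seq (c * u.1, u.2) | u <- s]; split.
  by move=> _ /mapP[u /Hs + ->].
by rewrite big_map scaler_sumr; apply: eq_bigr => u _; rewrite scalerA.
Qed.

Lemma normal_span_le m n x : (m <= n)%N -> normal_span m x -> normal_span n x.
Proof.
move=> mn [s [Hs ->]]; exists s; split=> // u /Hs[? d]; split=> //.
exact: leq_trans mn.
Qed.

Lemma normal_span_ind n (P : R -> Prop) :
    P 0 -> (forall x y, P x -> P y -> P (x + y)) ->
    (forall c e, normal e -> (degree e <= n)%N -> P (c *: monomial e)) ->
  forall x, normal_span n x -> P x.
Proof.
move=> P0 PD PM x [s [Hs ->]]; rewrite big_seq; apply: big_ind => // u /Hs[].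
exact: PM.
Qed.

Lemma normal_span_central n z x : z \in [:: Om; al; be; ga] ->
  normal_span n x -> normal_span n (z * x).
Proof.
move=> zZ; move: x; apply: normal_span_ind => [|x y|c [[[i j] k] [[[l r] s] t]] ne de].
- by exists [::]; rewrite big_nil mulr0.
- by rewrite mulrDr; apply: normal_span_add.
have OmX X m : X \in [:: A; B; C] -> GRing.comm Om (X ^+ m).
  by move=> XG; apply/commrX/casimir_comm.
have zM : GRing.comm z (A ^+ i * B ^+ j * C ^+ k).
  move: zZ; rewrite !inE => /or4P[]/eqP->; [|exact: alC|exact: beC|exact: gaC].
  by do ?apply: commrM; apply: OmX; rewrite !inE eqxx ?orbT.
have [f [fE fd]] : exists f : exponents,
    z * monomial ((i, j, k), (l, r, s, t)) = monomial f /\ f.1 = (i, j, k).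
  rewrite /monomial /central_monomial /= mulrA zM -mulrA.
  move: zZ; rewrite !inE => /or4P[]/eqP->.
  - by exists ((i, j, k), (l.+1, r, s, t)); rewrite /= exprS !mulrA.
  - exists ((i, j, k), (l, r.+1, s, t)); split=> //=; congr (_ * _).
    by rewrite mulrA (mulrA al) (mulrA al) alC -(mulrA _ al) -exprS.
  - exists ((i, j, k), (l, r, s.+1, t)); split=> //=; congr (_ * _).
    by rewrite mulrA (mulrA be) beC -(mulrA _ be) -exprS.
  - exists ((i, j, k), (l, r, s, t.+1)); split=> //=; congr (_ * _).
    by rewrite mulrA gaC -(mulrA _ ga) -exprS.
rewrite -scalerAr fE; apply/normal_span_scale/normal_span_monomial.
  by move: ne; rewrite /normal fd.
by move: de; rewrite /degree fd.
Qed.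

Definition ABC_mon (i j k : nat) : R := A ^+ i * B ^+ j * C ^+ k.

Lemma words_gen_ABC_mon X i j k : X \in [:: A; B; C] ->
  exists c i' j' k',
     words (i + j + k) (X * ABC_mon i j k - c *: ABC_mon i' j' k') /\
     (i' + j' + k' = (i + j + k).+1)%N.
Proof.
rewrite !inE => /or3P[] /eqP->; rewrite /ABC_mon.
- exists 1, i.+1, j, k; rewrite exprS scale1r !mulrA subrr !addSn; split=> //.
  exact: words0.
- have [||c wc] := @words_swap_exp B A i; rewrite ?inE ?eqxx ?orbT //.
  exists c, i, j.+1, k; rewrite addnS addSn; split=> //.
  have -> : B * (A ^+ i * B ^+ j * C ^+ k) - c *: (A ^+ i * B ^+ j.+1 * C ^+ k)
     = (B * A ^+ i - c *: (A ^+ i * B)) * (B ^+ j * C ^+ k).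
    by rewrite mulrBl -scalerAl exprS !mulrA.
  rewrite -addnA; apply: words_mul => //.
  by apply: words_mul; apply: words_exp; rewrite !inE eqxx ?orbT.
- have [||c wc] := @words_swap_exp C A i; rewrite ?inE ?eqxx ?orbT //.
  have [||d wd] := @words_swap_exp C B j; rewrite ?inE ?eqxx ?orbT //.
  exists (c * d), i, j, k.+1; rewrite addnS; split=> //.
  have -> : C * (A ^+ i * B ^+ j * C ^+ k)
      - (c * d) *: (A ^+ i * B ^+ j * C ^+ k.+1)
     = (C * A ^+ i - c *: (A ^+ i * C)) * (B ^+ j * C ^+ k)
       + c *: (A ^+ i * (C * B ^+ j - d *: (B ^+ j * C)) * C ^+ k).
    rewrite mulrBl mulrBr mulrBl scalerBr -!scalerAl -!scalerAr -scalerAl.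
    by rewrite scalerA exprS !mulrA addrA subrK.
  apply: words_add; rewrite -?addnA.
    apply: words_mul => //.
    by apply: words_mul; apply: words_exp; rewrite !inE eqxx ?orbT.
  apply: words_scale; rewrite -mulrA; apply: words_mul.
    by apply: words_exp; rewrite !inE eqxx.
  by apply: words_mul => //; apply: words_exp; rewrite !inE eqxx ?orbT.
Qed.

(** The definition of Omega, solved for A B C. *)
Lemma words_ABC : words 2 (A * B * C).
Proof.
have -> : A * B * C = q^-1 *: (Om + q *: (A * al) + q^-1 *: (B * be)
   + q *: (C * ga) - q ^+ 2 *: (A * A) - q ^- 2 *: (B * B) - q ^+ 2 *: (C * C)).
  by rewrite /casimir; linear_eq F; field.
have w2 X : X \in [:: A; B; C] -> words 2 (X * X).
  by move=> XG; apply: words_cons => //; apply: words1.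
have wz X z : X \in [:: A; B; C] -> z \in [:: Om; al; be; ga] -> words 2 (X * z).
  by move=> XG zZ; apply: words_cons => //; apply/words_leS/words_central1.
apply: words_scale.
do 3?[apply: words_sub; last by apply: words_scale; apply: w2; rewrite !inE eqxx ?orbT].
do 3?[apply: words_add; last by apply: words_scale; apply: wz; rewrite !inE eqxx ?orbT].
by apply/words_leS/words_leS/words_central1; rewrite inE eqxx.
Qed.

(** When i, j, k are all positive, A moves next to the last B, at the cost of
    shorter words, and A B C then drops the length. *)
Lemma ABC_mon_normal_span n i j k : (forall y, words n y -> normal_span n y) ->
  (i + j + k <= n.+1)%N -> normal_span n.+1 (ABC_mon i j k).
Proof.
move=> IH le_n.
have [ne|] := boolP (normal ((i, j, k), (0, 0, 0, 0)%N)).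
  have -> : ABC_mon i j k = monomial ((i, j, k), (0, 0, 0, 0)%N).
    by rewrite /monomial /= !expr0 !mulr1.
  exact: normal_span_monomial.
case: i j k le_n => [|i] [|j] [|k] //= le_n _.
have [||c wc] := @words_swap_exp A B j; rewrite ?inE ?eqxx ?orbT //.
apply: (normal_span_le (leqnSn n)); apply: IH.
have -> : ABC_mon i.+1 j.+1 k.+1 =
    A ^+ i * (A * B ^+ j - c *: (B ^+ j * A)) * (B * C ^+ k.+1)
    + c *: (A ^+ i * B ^+ j * (A * B * C) * C ^+ k).
  rewrite mulrBr mulrBl -!scalerAr -!scalerAl /ABC_mon [A ^+ i.+1]exprSr.
  by rewrite [B ^+ j.+1]exprSr exprS !mulrA subrK.
have wX X m : X \in [:: A; B; C] -> words m (X ^+ m) by exact: words_exp.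
apply: words_add; last apply: words_scale.
  apply: (@words_le (i + j + k.+2)); first by lia.
  apply: words_mul; last first.
    by apply: words_cons; [|apply: wX]; rewrite !inE eqxx ?orbT.
  by apply: words_mul => //; apply: wX; rewrite !inE eqxx ?orbT.
apply: (@words_le (i + j + 2 + k)); first by lia.
apply: words_mul; last by apply: wX; rewrite !inE eqxx ?orbT.
apply: words_mul words_ABC.
by apply: words_mul; apply: wX; rewrite !inE eqxx ?orbT.
Qed.

Lemma words_normal_span n x : words n x -> normal_span n x.
Proof.
elim/ltn_ind: n x => n IH x wx; elim: wx IH => {n x}
  [n|n x y _ Nx _ Ny|n c x _ Nx|n z x zZ _ Nx|n X x XG _ Nx] IH.
- have -> : 1 = monomial ((0, 0, 0), (0, 0, 0, 0))%N.
    by rewrite /monomial /= !expr0 !mulr1.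
  exact: normal_span_monomial.
- by apply: normal_span_add; [apply: Nx|apply: Ny].
- exact/normal_span_scale/Nx.
- exact/normal_span_central/Nx.
(* Only a new leftmost letter lengthens a word, and it meets a normal monomial. *)
have le_n : forall y, words n y -> normal_span n y by apply: IH.
have {}Nx : normal_span n x by apply: Nx => k lt_kn; apply: IH; rewrite leqW.
move: x Nx; apply: normal_span_ind => [|x y Nx Ny|c [[[i j] k] e] _ de].
- by rewrite mulr0; exists [::]; rewrite big_nil.
- by rewrite mulrDr; apply: normal_span_add.
rewrite /degree /= in de; rewrite -scalerAr; apply: normal_span_scale.
have [d [i' [j' [k' [wd deg]]]]] := words_gen_ABC_mon i j k XG.
have Nabc : normal_span n.+1 (X * ABC_mon i j k).
  rewrite -[X * _](subrK (d *: ABC_mon i' j' k')); apply: normal_span_add.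
    by apply/(normal_span_le (leqnSn n))/le_n; apply: words_le wd.
  by apply/normal_span_scale/ABC_mon_normal_span => //; rewrite deg.
have -> : X * monomial ((i, j, k), e) = central_monomial e * (X * ABC_mon i j k).
  have comm_e Y : Y \in [:: A; B; C] -> GRing.comm Y (central_monomial e).
    move=> YG; case: e => [[[l r] s] t].
    by do ?apply: commrM; apply: commrX; apply/esym;
      [exact: casimir_comm|exact: alC|exact: beC|exact: gaC].
  have -> : GRing.comm (central_monomial e) (X * ABC_mon i j k);
    last by rewrite -mulrA.
  do ?apply: commrM; try apply: commrX; apply/esym/comm_e => //;
    by rewrite !inE eqxx ?orbT.
have zexp z m y : z \in [:: Om; al; be; ga] -> normal_span n.+1 y ->
    normal_span n.+1 (z ^+ m * y).
  move=> zZ Ny; elim: m => [|m IHm]; first by rewrite mul1r.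
  by rewrite exprS -mulrA; apply: normal_span_central.
case: e {de} => [[[l r] s] t]; rewrite /= -3!mulrA.
by do 4![apply: (zexp); first by rewrite !inE eqxx ?orbT].
Qed.
End Spanning.

Section DeltaSpan.
Variables (F : fieldType) (q : F).
Hypotheses (q_neq0 : q != 0) (q4_neq1 : q ^+ 4 != 1).
Local Notation A := (Agen q).
Local Notation B := (Bgen q).
Local Notation C := (Cgen q).

Lemma Delta_central :
  [/\ central (aw_scaled q A B C), central (aw_scaled q B C A)
    & central (aw_scaled q C A B)].
Proof.
have H (a b c : freeAlg F 'I_3) :
    (forall x, Delta_rel q (gen F 0) (gen F 1) (gen F 2)
       (commutator (aw_elt q a b c) x)) ->
    central (aw_scaled q (qpi (Relators (Delta_proper (q := q))) a) (qpi _ b) (qpi _ c)).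
  move=> rel y; have [x ->] := qpi_surj y.
  have := qpi0 (S := Relators (Delta_proper (q := q))) (rel x).
  rewrite lrmorph_commutator lrmorph_aw_elt /commutator => /eqP.
  rewrite subr_eq0 => /eqP e.
  by rewrite /aw_scaled -scalerAl -scalerAr e.
by split; apply: H => x; constructor.
Qed.

Lemma Delta_words x : exists n, words q A B C n x.
Proof.
have [y ->] := qpi_surj x; move: y.
apply: freeAlg_ind => [c|y z [m wy] [n wz]|y z [m wy] [n wz]|i].
- by exists 0%N; rewrite linearZ rmorph1; apply/words_scale/words_one.
- exists (m + n)%N; rewrite raddfD; apply: words_add.
    by apply: words_le wy; rewrite leq_addr.
  by apply: words_le wz; rewrite leq_addl.
- by exists (m + n)%N; rewrite rmorphM; apply: words_mul.
exists 1%N; have [wA wB wC] := words1_ABC q A B C.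
have /or3P[] : [|| i == 0, i == 1 | i == 2] by case: i => [[|[|[|]]]].
- by move/eqP->.
- by move/eqP->.
- by move/eqP->.
Qed.

(** Uniqueness and nonzero coefficients let the independence argument single out
    one term. *)
Lemma collect_terms (V : lmodType F) (I : eqType) (g : I -> V) (s : seq (F * I)) :
  exists S c, [/\ uniq S, {subset S <= [seq u.2 | u <- s]},
    forall e, e \in S -> c e != 0
    & \sum_(u <- s) u.1 *: g u.2 = \sum_(e <- S) c e *: g e].
Proof.
pose c e := \sum_(u <- s | u.2 == e) u.1; pose U := undup [seq u.2 | u <- s].
exists [seq e <- U | c e != 0], c; split.
- by rewrite filter_uniq ?undup_uniq.
- by move=> e; rewrite mem_filter mem_undup => /andP[].
- by move=> e; rewrite mem_filter => /andP[].
rewrite big_filter [RHS]big_mkcond /=.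
transitivity (\sum_(e <- U) c e *: g e); last first.
  by apply: eq_bigr => e _; case: eqP => //= ->; rewrite scale0r.
transitivity (\sum_(e <- U) \sum_(u <- s | u.2 == e) u.1 *: g u.2); last first.
  by apply: eq_bigr => e _; rewrite scaler_suml; apply: eq_bigr => u /eqP->.
rewrite (exchange_big_dep xpredT) //= big_seq [RHS]big_seq.
apply: eq_bigr => u us; rewrite -big_filter.
rewrite (_ : [seq e <- U | u.2 == e] = [:: u.2]) ?big_seq1 //.
have := @filter_pred1_uniq _ U u.2 (undup_uniq _).
rewrite mem_undup map_f // => /(_ isT) <-.
by apply: eq_filter => e; rewrite /= eq_sym.
Qed.

Lemma Delta_normal_form (x : Delta q) : exists S c,
  [/\ uniq S, forall e, e \in S -> normal e, forall e, e \in S -> c e != 0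
    & x = \sum_(e <- S) c e *: monomial q A B C e].
Proof.
have [alC beC gaC] := Delta_central.
have [n /(words_normal_span q_neq0 q4_neq1 alC beC gaC)[s [Hs ->]]] := Delta_words x.
have [S [c [uS subS cS ->]]] := collect_terms (monomial q A B C) s.
exists S, c; split=> // e /subS /mapP[u us ->].
by have [] := Hs _ us.
Qed.
End DeltaSpan.

(** * The algebra of linear operators *)

(** [v m false] and [v m true] are the coordinates on the eigenlines numbered
    2m and 2m + 1 of the chain. *)
Definition vec (K : fieldType) : Type := int -> bool -> K.

Definition vec_linear (K : fieldType) (f : vec K -> vec K) : Prop :=
  (forall v w, f (fun m b => v m b + w m b) = fun m b => f v m b + f w m b) /\
  (forall c v, f (fun m b => c * v m b) = fun m b => c * f v m b).

(** The parameter [iota] is a phantom: it lets K-linear operators carry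
    an F-algebra structure. *)
Record op (F K : fieldType) (iota : {rmorphism F -> K}) : Type :=
  Op { op_fun :> vec K -> vec K; op_linear : vec_linear op_fun }.

Section Operators.
Variables (F K : fieldType) (iota : {rmorphism F -> K}).
Local Notation op := (op iota).
Implicit Types f g h : op.

Lemma opP (f g : op) : (forall v m b, f v m b = g v m b) -> f = g.
Proof.
case: f g => f hf [g hg] /= fg.
have efg : f = g by apply: funext => v; apply: funext => m; apply: funext => b.
by subst g; congr Op; exact: Prop_irrelevance.
Qed.

HB.instance Definition _ := gen_eqMixin op.
HB.instance Definition _ := gen_choiceMixin op.

Lemma op_addv (f : op) v w : f (fun m b => v m b + w m b) = fun m b => f v m b + f w m b.
Proof. by case: (op_linear f). Qed.
Lemma op_scalev (f : op) c v : f (fun m b => c * v m b) = fun m b => c * f v m b.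
Proof. by case: (op_linear f). Qed.

Program Definition op_zero := @Op _ _ iota (fun v m b => 0) _.
Next Obligation.
by split=> *; apply: funext => m; apply: funext => b; rewrite ?addr0 ?mulr0.
Qed.
Program Definition op_add (f g : op) := @Op _ _ iota (fun v m b => f v m b + g v m b) _.
Next Obligation.
split=> *; apply: funext => m; apply: funext => b;
  by rewrite ?op_addv ?op_scalev ?mulrDr // addrACA.
Qed.
Program Definition op_opp (f : op) := @Op _ _ iota (fun v m b => - f v m b) _.
Next Obligation.
split=> *; apply: funext => m; apply: funext => b;
  by rewrite ?op_addv ?op_scalev ?mulrN // opprD.
Qed.
Program Definition op_one := @Op _ _ iota (fun v => v) _.
Next Obligation. by []. Qed.
Program Definition op_mul (f g : op) := @Op _ _ iota (fun v => f (g v)) _.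
Next Obligation. by split=> *; rewrite ?op_addv ?op_scalev. Qed.
Program Definition op_scale (c : F) (f : op) :=
  @Op _ _ iota (fun v m b => iota c * f v m b) _.
Next Obligation.
split=> *; apply: funext => m; apply: funext => b; rewrite ?op_addv ?op_scalev ?mulrDr //.
by rewrite mulrCA.
Qed.

Fact op_addA : associative op_add.
Proof. by move=> f g h; apply: opP => v m b /=; rewrite addrA. Qed.
Fact op_addC : commutative op_add.
Proof. by move=> f g; apply: opP => v m b /=; rewrite addrC. Qed.
Fact op_add0 : left_id op_zero op_add.
Proof. by move=> f; apply: opP => v m b /=; rewrite add0r. Qed.
Fact op_addN : left_inverse op_zero op_opp op_add.
Proof. by move=> f; apply: opP => v m b /=; rewrite addNr. Qed.
HB.instance Definition _ :=
  GRing.isZmodule.Build op op_addA op_addC op_add0 op_addN.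

Fact op_mulA : associative op_mul. Proof. by move=> f g h; apply: opP. Qed.
Fact op_mul1 : left_id op_one op_mul. Proof. by move=> f; apply: opP. Qed.
Fact op_mulr1 : right_id op_one op_mul. Proof. by move=> f; apply: opP. Qed.
Fact op_mulDl : left_distributive op_mul op_add.
Proof. by move=> f g h; apply: opP. Qed.
Fact op_mulDr : right_distributive op_mul op_add.
Proof. by move=> f g h; apply: opP => v m b /=; rewrite op_addv. Qed.
Fact op_one_neq0 : op_one != op_zero.
Proof.
apply/eqP => /(congr1 (fun f : op => (f (fun _ _ => 1) 0 true))) /= /eqP.
by rewrite oner_eq0.
Qed.
HB.instance Definition _ := GRing.Zmodule_isNzRing.Build op
  op_mulA op_mul1 op_mulr1 op_mulDl op_mulDr op_one_neq0.

Fact op_scaleA a b f : op_scale a (op_scale b f) = op_scale (a * b) f.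
Proof. by apply: opP => v m e /=; rewrite mulrA rmorphM. Qed.
Fact op_scale1 : left_id 1 op_scale.
Proof. by move=> f; apply: opP => v m b /=; rewrite rmorph1 mul1r. Qed.
Fact op_scaleDr : right_distributive op_scale op_add.
Proof. by move=> c f g; apply: opP => v m b /=; rewrite mulrDr. Qed.
Fact op_scaleDl f : {morph op_scale^~ f : a b / a + b >-> op_add a b}.
Proof. by move=> a c; apply: opP => v m b /=; rewrite rmorphD mulrDl. Qed.
HB.instance Definition _ := GRing.Zmodule_isLmodule.Build F op
  op_scaleA op_scale1 op_scaleDr op_scaleDl.
Fact op_scaleAl (a : F) (f g : op) : a *: (f * g) = a *: f * g.
Proof. by apply: opP. Qed.
HB.instance Definition _ := GRing.Lmodule_isLalgebra.Build F op op_scaleAl.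
Fact op_scaleAr (a : F) (f g : op) : a *: (f * g) = f * (a *: g).
Proof. by apply: opP => v m b /=; rewrite op_scalev. Qed.
HB.instance Definition _ := GRing.Lalgebra_isAlgebra.Build F op op_scaleAr.
End Operators.

(** * The chain modules *)

Section ChainModule.
Variables (F K : fieldType) (iota : {rmorphism F -> K}) (q : F).
Variables (a k T1 T2 T3 : K).
Hypotheses (q_neq0 : q != 0) (q4_neq1 : q ^+ 4 != 1).
Hypotheses (a_neq0 : a != 0) (k_neq0 : k != 0).
Hypothesis a_generic : forall n : int, (a * iota q ^ n) ^+ 2 != 1.

Local Notation Q := (iota q).
Local Notation op := (op iota).

(** [k] is the eigenvalue of t_0 whose eigenspace is used below; [T1], [T2], [T3]
    are the values of t_i + 1/t_i. *)
Definition T0 : K := k + k^-1.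
(** t_0 t_1 acts on the lines 2m and 2m + 1 by [lam m] and its inverse; t_2 t_3,
    which is q^-1 times the inverse of t_0 t_1, acts on the lines 2m + 1 and
    2m + 2 by [mu m] and its inverse. *)
Definition lam (m : int) : K := a * Q ^ (- (2 * m)).
Definition mu (m : int) : K := lam m / Q.
(** If M has determinant 1 and trace S, its inverse times diag (x, 1/x) has
    trace (S - p) x + p / x, where p is the top left entry of M; this is the
    value of p that makes that trace T. *)
Definition diag_coef (S T x : K) : K := (T - S * x) / (x^-1 - x).
Definition t0_diag m := diag_coef T0 T1 (lam m).
Definition t3_diag m := diag_coef T3 T2 (mu m).
(** Rescaling the eigenlines makes one off-diagonal entry of every 2 x 2 block
    equal to 1; determinant 1 then fixes the other one. *)
Definition t0_off m := t0_diag m * (T0 - t0_diag m) - 1.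
Definition t3_off m := t3_diag m * (T3 - t3_diag m) - 1.

Lemma Q_neq0 : Q != 0. Proof. by rewrite fmorph_eq0. Qed.
Let nzQ := Q_neq0.

Lemma lam_neq0 m : lam m != 0.
Proof. by rewrite mulf_neq0 // expfz_neq0. Qed.

Lemma mu_neq0 m : mu m != 0.
Proof. by rewrite mulf_neq0 ?lam_neq0 // invr_eq0. Qed.

Lemma lamD1 m : lam (m + 1) = lam m / Q ^+ 2.
Proof.
by rewrite /lam mulrDr opprD expfzDr // mulrA.
Qed.

Lemma lam_sqr m : lam m ^+ 2 != 1. Proof. exact: a_generic. Qed.

Lemma mu_sqr m : mu m ^+ 2 != 1.
Proof.
have -> : mu m = a * Q ^ (- (2 * m) - 1).
  by rewrite /mu /lam -mulrA; congr (_ * _); rewrite expfzDr // exprN1.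
exact: a_generic.
Qed.

Lemma gap_neq0 (x : K) : x != 0 -> x ^+ 2 != 1 -> x^-1 - x != 0.
Proof.
move=> x0; apply: contra; rewrite subr_eq0 => /eqP h.
by rewrite expr2 -{1}h mulVf.
Qed.

Lemma diag_trace (S T x : K) : x != 0 -> x ^+ 2 != 1 ->
  (S - diag_coef S T x) * x + diag_coef S T x / x = T.
Proof.
move=> x0 x1; rewrite /diag_coef; have nz := gap_neq0 x0 x1.
have nz1 : x ^+ 2 - 1 != 0 by rewrite subr_eq0.
have -> : x^-1 - x = - (x ^+ 2 - 1) / x by field.
by field; rewrite ?x0 oppr_eq0 ?nz1.
Qed.

Lemma op_funD (f g : op) v m b : (f + g) v m b = f v m b + g v m b.
Proof. by []. Qed.
Lemma op_funN (f : op) v m b : (- f) v m b = - f v m b.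
Proof. by []. Qed.
Lemma op_funM (f g : op) v : (f * g) v = f (g v).
Proof. by []. Qed.
Lemma op_funZ c (f : op) v m b : (c *: f) v m b = iota c * f v m b.
Proof. by []. Qed.
Lemma op_fun1 v : (1 : op) v = v.
Proof. by []. Qed.

Ltac op_lin := by split=> *; apply: funext => ?; apply: funext; case=> /=; ring.

Program Definition scal (c : K) : op := @Op _ _ iota (fun v m b => c * v m b) _.
Next Obligation. op_lin. Qed.

Program Definition t0_op : op := @Op _ _ iota (fun v m b =>
  if b then v m false + (T0 - t0_diag m) * v m true
  else t0_diag m * v m false + t0_off m * v m true) _.
Next Obligation. op_lin. Qed.

Program Definition t3_op : op := @Op _ _ iota (fun v m b =>
  if b then t3_diag m * v m true + t3_off m * v (m + 1) false
  else v (m - 1) true + (T3 - t3_diag (m - 1)) * v m false) _.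
Next Obligation. op_lin. Qed.

Program Definition diag_op (x y : int -> K) : op := @Op _ _ iota (fun v m b =>
  (if b then y m else x m) * v m b) _.
Next Obligation. op_lin. Qed.

(** The diagonal operators t_0 t_1 and t_2 t_3. *)
Definition eig01 : op := diag_op lam (fun m => (lam m)^-1).
Definition eig01_inv : op := diag_op (fun m => (lam m)^-1) lam.
Definition eig23 : op := diag_op (fun m => (mu (m - 1))^-1) mu.
Definition eig23_inv : op := diag_op (fun m => mu (m - 1)) (fun m => (mu m)^-1).
Definition t0_inv : op := scal T0 - t0_op.
Definition t3_inv : op := scal T3 - t3_op.

Definition chain_t (i : 'I_4) : op :=
  nth 0 [:: t0_op; t0_inv * eig01; eig23 * t3_inv; t3_op] i.
Definition chain_tV (i : 'I_4) : op :=
  nth 0 [:: t0_inv; eig01_inv * t0_op; t3_op * eig23_inv; t3_inv] i.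
Definition chain_T (i : 'I_4) : K := nth 0 [:: T0; T1; T2; T3] i.

Lemma t0K : t0_op * t0_inv = 1.
Proof. by apply: opP => v m; case=> /=; rewrite /t0_off; ring. Qed.
Lemma t0Ki : t0_inv * t0_op = 1.
Proof. by apply: opP => v m; case=> /=; rewrite /t0_off; ring. Qed.
Lemma t3K : t3_op * t3_inv = 1.
Proof.
by apply: opP => v m; case=> /=; rewrite /t3_off ?addrK ?subrK; ring.
Qed.
Lemma t3Ki : t3_inv * t3_op = 1.
Proof.
by apply: opP => v m; case=> /=; rewrite /t3_off ?addrK ?subrK; ring.
Qed.
Lemma eig01K : eig01 * eig01_inv = 1.
Proof.
by apply: opP => v m; case=> /=; rewrite mulrA ?mulfV ?mulVf ?mul1r ?lam_neq0.
Qed.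
Lemma eig01Ki : eig01_inv * eig01 = 1.
Proof.
by apply: opP => v m; case=> /=; rewrite mulrA ?mulfV ?mulVf ?mul1r ?lam_neq0.
Qed.
Lemma eig23K : eig23 * eig23_inv = 1.
Proof.
by apply: opP => v m; case=> /=; rewrite mulrA ?mulfV ?mulVf ?mul1r ?mu_neq0.
Qed.
Lemma eig23Ki : eig23_inv * eig23 = 1.
Proof.
by apply: opP => v m; case=> /=; rewrite mulrA ?mulfV ?mulVf ?mul1r ?mu_neq0.
Qed.

Lemma scal_central c : central (scal c).
Proof. by move=> f; apply: opP => v m b /=; rewrite op_scalev. Qed.

Lemma ord4P (P : 'I_4 -> Prop) : P 0 -> P 1 -> P 2 -> P 3 -> forall i, P i.
Proof.
move=> h0 h1 h2 h3 [[|[|[|[|//]]]] lt_i].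
- by rewrite (_ : Ordinal _ = 0) //; apply/val_inj.
- by rewrite (_ : Ordinal _ = 1) //; apply/val_inj.
- by rewrite (_ : Ordinal _ = 2) //; apply/val_inj.
- by rewrite (_ : Ordinal _ = 3) //; apply/val_inj.
Qed.

Lemma chain_tK i : chain_t i * chain_tV i = 1.
Proof.
elim/ord4P: i; rewrite /chain_t /chain_tV /=.
- exact: t0K.
- exact: mulr_pairK t0Ki eig01K.
- exact: mulr_pairK eig23K t3Ki.
- exact: t3K.
Qed.

Lemma chain_tVK i : chain_tV i * chain_t i = 1.
Proof.
elim/ord4P: i; rewrite /chain_t /chain_tV /=.
- exact: t0Ki.
- exact: mulr_pairK eig01Ki t0K.
- exact: mulr_pairK t3K eig23Ki.
- exact: t3Ki.
Qed.

(** Inverses being S - M for M of trace S and determinant 1, the centrality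
    relations amount to trace computations. *)
Lemma chain_trace i : chain_t i + chain_tV i = scal (chain_T i).
Proof.
elim/ord4P: i; rewrite /chain_t /chain_tV /chain_T /=.
- by rewrite addrC subrK.
- apply: opP => v m; have tr := diag_trace T0 T1 (lam_neq0 m) (lam_sqr m).
  by case=> /=; rewrite -/(t0_diag m) in tr *; rewrite -[in RHS]tr; ring.
- apply: opP => v m; case=> /=.
    have tr := diag_trace T3 T2 (mu_neq0 m) (mu_sqr m).
    by rewrite ?addrK -/(t3_diag m) in tr *; rewrite -[in RHS]tr; ring.
  have tr := diag_trace T3 T2 (mu_neq0 (m - 1)) (mu_sqr (m - 1)).
  by rewrite ?subrK -/(t3_diag (m - 1)) in tr *; rewrite -[in RHS]tr; ring.
- by rewrite addrC subrK.
Qed.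

Lemma chain_central i : central (chain_t i + chain_tV i).
Proof. by rewrite chain_trace; apply: scal_central. Qed.

Lemma chain_prod : chain_t 0 * chain_t 1 * chain_t 2 * chain_t 3 = q^-1%:A.
Proof.
rewrite /chain_t /= -!mulrA t3Ki mulr1 (mulrA t0_op) t0K mul1r.
apply: opP => v m b /=; rewrite fmorphV.
case: b; rewrite mulrA; congr (_ * _).
  by rewrite /mu mulrA mulVf ?lam_neq0 // mul1r.
have -> : mu (m - 1) = lam m * Q.
  by rewrite /mu -{2}[m](subrK 1) lamD1; field.
by rewrite invfM mulrA mulfV ?lam_neq0 // mul1r.
Qed.

(** * The action on an eigenspace of t_0 *)

Definition theta m := lam m + (lam m)^-1.
(** Matrix entries of B and C on the eigenspace; their coefficients from index m
    to m + 1 are 1 and - 1 / mu m. *)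
Definition B_diag m := k * t3_diag m + t0_diag m * (T3 - t3_diag m)
   - t3_diag (m - 1) * (t0_diag m - k^-1).
Definition C_diag m := k * mu m * (T3 - t3_diag m) + t0_diag m * t3_diag m / mu m
   - (T3 - t3_diag (m - 1)) * mu (m - 1) * (t0_diag m - k^-1).
Definition B_low m := (k - t0_diag m) * t3_off m * (t0_diag (m + 1) - k^-1).

Definition seqA (y : int -> K) m := theta m * y m.
Definition seqB (y : int -> K) m :=
  y (m - 1) + B_diag m * y m + B_low m * y (m + 1).
Definition seqC (y : int -> K) m :=
  - (mu (m - 1))^-1 * y (m - 1) + C_diag m * y m - mu m * B_low m * y (m + 1).

(** The odd row of (t_0 - k) v = 0 recovers the even coordinate from the odd
    one. *)
Definition eigvec (y : int -> K) : vec K :=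
  fun m b => if b then y m else (t0_diag m - k^-1) * y m.

Lemma t0_eigvec y : t0_op (eigvec y) = fun m b => k * eigvec y m b.
Proof.
apply: funext => m; apply: funext; case=> /=; rewrite /t0_off /T0; first by ring.
by field.
Qed.

Lemma eigvec_of_t0 v : t0_op v = (fun m b => k * v m b) -> v = eigvec (v^~ true).
Proof.
move=> h; apply: funext => m; apply: funext; case=> //=.
have /= e := congr1 (fun w : vec K => w m true) h.
by rewrite -[LHS](addrK ((T0 - t0_diag m) * v m true)) e /T0; ring.
Qed.

Definition opA : op := chain_t 1 * chain_t 0 + chain_tV 0 * chain_tV 1.
Definition opB : op := chain_t 3 * chain_t 0 + chain_tV 0 * chain_tV 3.
Definition opC : op := chain_t 2 * chain_t 0 + chain_tV 0 * chain_tV 2.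

(** So only the odd coordinates of the image have to be computed. *)
Lemma comm_t0_eigvec (X : op) y : GRing.comm t0_op X ->
  X (eigvec y) = eigvec (fun m => X (eigvec y) m true).
Proof.
move=> tX; apply: eigvec_of_t0.
by rewrite -[LHS]/((t0_op * X) (eigvec y)) tX op_funM t0_eigvec op_scalev.
Qed.

Lemma chain_t0_comm i :
  GRing.comm t0_op (chain_t i * chain_t 0 + chain_tV 0 * chain_tV i).
Proof.
exact: (t0_comm chain_tK chain_tVK chain_central).
Qed.

Lemma opA_eigvec y : opA (eigvec y) = eigvec (seqA y).
Proof.
rewrite comm_t0_eigvec; last exact: chain_t0_comm.
congr eigvec; apply: funext => m; rewrite /opA /chain_t /chain_tV /=.
by rewrite /seqA /theta /t0_off; ring.
Qed.

Lemma opB_eigvec y : opB (eigvec y) = eigvec (seqB y).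
Proof.
rewrite comm_t0_eigvec; last exact: chain_t0_comm.
congr eigvec; apply: funext => m; rewrite /opB /chain_t /chain_tV.
rewrite op_funD !op_funM t0_eigvec /= ?addrK ?subrK.
by rewrite /seqB /B_diag /B_low /T0 /t3_off; field.
Qed.

Lemma opC_eigvec y : opC (eigvec y) = eigvec (seqC y).
Proof.
rewrite comm_t0_eigvec; last exact: chain_t0_comm.
congr eigvec; apply: funext => m; rewrite /opC /chain_t /chain_tV.
rewrite op_funD !op_funM t0_eigvec /= ?addrK ?subrK.
by rewrite /seqC /C_diag /B_low /T0 /t3_off; field; rewrite ?mu_neq0 ?k_neq0.
Qed.

(** The eigenvalue of q^-1 t_0 + q t_0^-1, then the scalars by which alpha, beta,
    gamma and Omega act. *)
Definition u_val := k / Q + Q / k.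
Definition alpha_val := T1 * u_val + T2 * T3.
Definition beta_val := T3 * u_val + T1 * T2.
Definition gamma_val := T2 * u_val + T3 * T1.
Definition casimir_val := (Q + Q^-1) ^+ 2 - u_val ^+ 2 - T1 ^+ 2 - T2 ^+ 2 - T3 ^+ 2
  - u_val * T1 * T2 * T3.

Lemma lamB1 m : lam (m - 1) = lam m * Q ^+ 2.
Proof. by rewrite -{2}[m](subrK 1) lamD1; field. Qed.

(** The denominators occurring in the matrix entries are all of these two
    forms. *)
Lemma lam_gap m (n : nat) : 1 - (lam m * Q ^+ n) ^+ 2 != 0.
Proof.
by rewrite subr_eq0 eq_sym /lam -mulrA -[Q ^+ n]/(Q ^ n) -expfzDr.
Qed.

Lemma lam_gapV m (n : nat) : (Q ^+ n) ^+ 2 - lam m ^+ 2 != 0.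
Proof.
have Qn : Q ^+ n != 0 by rewrite expf_neq0.
rewrite subr_eq0 eq_sym; apply/eqP => e.
have /eqP[] : (lam m * Q ^ (- n%:Z)) ^+ 2 != 1.
  by rewrite /lam -mulrA -expfzDr //; exact: a_generic.
by rewrite -exprnN exprMn e -exprMn mulfV ?expr1n.
Qed.

Ltac gap_case e m n := first
  [ (have -> : e = 1 - (lam m * Q ^+ n) ^+ 2 by ring); exact: lam_gap
  | (have -> : e = (Q ^+ n) ^+ 2 - lam m ^+ 2 by ring); exact: lam_gapV ].

Ltac lam_gaps m :=
  rewrite ?k_neq0 ?nzQ ?lam_neq0 //=; repeat (apply/andP; split);
  match goal with |- is_true (?e != 0) => first
    [ gap_case e m 0%N | gap_case e m 1%N | gap_case e m 2%N
    | gap_case e m 3%N | gap_case e m 4%N ] end.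

(** After every index is brought back to m, an identity between compositions of
    the tridiagonal operators is one between rational functions of [lam m]. *)
Ltac seq_field m :=
  rewrite /seqA /seqB /seqC ?addrK ?subrK;
  rewrite /theta /B_diag /C_diag /B_low /t3_off /t0_diag /t3_diag /mu;
  rewrite ?addrK ?subrK !(lamD1, lamB1) ?addrK ?subrK;
  rewrite /diag_coef /T0 /alpha_val /beta_val /gamma_val /casimir_val /u_val;
  field; lam_gaps m.

Lemma seq_casimir y m :
  Q * seqA (seqB (seqC y)) m + Q ^+ 2 * seqA (seqA y) m
  + Q ^- 2 * seqB (seqB y) m + Q ^+ 2 * seqC (seqC y) m
  - Q * seqA (fun m => alpha_val * y m) m - Q^-1 * seqB (fun m => beta_val * y m) m
  - Q * seqC (fun m => gamma_val * y m) m = casimir_val * y m.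
Proof. seq_field m. Qed.

Lemma seq_awA y m :
  (Q ^+ 2 - Q ^- 2) * seqA y m + Q * seqB (seqC y) m - Q^-1 * seqC (seqB y) m
  = (Q - Q^-1) * alpha_val * y m.
Proof. seq_field m. Qed.

Lemma seq_awB y m :
  (Q ^+ 2 - Q ^- 2) * seqB y m + Q * seqC (seqA y) m - Q^-1 * seqA (seqC y) m
  = (Q - Q^-1) * beta_val * y m.
Proof. seq_field m. Qed.

Lemma seq_awC y m :
  (Q ^+ 2 - Q ^- 2) * seqC y m + Q * seqA (seqB y) m - Q^-1 * seqB (seqA y) m
  = (Q - Q^-1) * gamma_val * y m.
Proof. seq_field m. Qed.

Lemma chain_rep : exists rho : {lrmorphism Hhat q_neq0 -> op},
  (forall i, rho (tgen q_neq0 i) = chain_t i) /\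
  (forall i, rho (tVgen q_neq0 i) = chain_tV i).
Proof.
have [f fg] := free_lrmorphism (fun x : 'I_4 * bool =>
  if x.2 then chain_tV x.1 else chain_t x.1).
have f0 x : Hhat_presentation q x -> f x = 0.
  apply: Hhat_rel_ker => [i|i|i|]; rewrite !fg /=.
  - exact: chain_tK.
  - exact: chain_tVK.
  - exact: chain_central.
  - exact: chain_prod.
have [g gE] := quot_lift_lrmorphism (S := Relators (Hhat_proper q_neq0)) f0.
by exists g; split=> i; rewrite gE fg.
Qed.

Lemma eigvecE z m b : eigvec z m b = (if b then 1 else t0_diag m - k^-1) * z m.
Proof. by rewrite /eigvec; case: b; rewrite ?mul1r. Qed.

Lemma aw_eigvec (X1 X2 X3 : op) (Y1 Y2 Y3 : (int -> K) -> int -> K) v :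
    (forall y, X1 (eigvec y) = eigvec (Y1 y)) ->
    (forall y, X2 (eigvec y) = eigvec (Y2 y)) ->
    (forall y, X3 (eigvec y) = eigvec (Y3 y)) ->
    (forall y m, (Q ^+ 2 - Q ^- 2) * Y1 y m + Q * Y2 (Y3 y) m
                 - Q^-1 * Y3 (Y2 y) m = (Q - Q^-1) * v * y m) ->
  forall y, aw_scaled q X1 X2 X3 (eigvec y) = eigvec (fun m => v * y m).
Proof.
move=> h1 h2 h3 h y; apply: funext => m; apply: funext => b.
rewrite /aw_scaled /aw_elt !(op_funZ, op_funD, op_funN) !op_funM.
rewrite h1 h3 h2 h2 h3.
have nz : Q ^+ 2 - Q ^- 2 != 0.
  by rewrite -!(rmorphXn, fmorphV) -rmorphB fmorph_eq0 aw_den_neq0.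
have nz2 : Q - Q^-1 != 0 by rewrite -fmorphV -rmorphB fmorph_eq0 qBV_neq0.
rewrite !eigvecE.
have -> : v * y m = (Q - Q^-1)^-1 * ((Q ^+ 2 - Q ^- 2) * Y1 y m
    + Q * Y2 (Y3 y) m - Q^-1 * Y3 (Y2 y) m) by rewrite h -mulrA mulKf.
rewrite rmorphD !(fmorphV, rmorphB, rmorphXn) /=.
set w := if b then _ else _; move: (Y1 y m) (Y2 _ m) (Y3 _ m) => y1 y2 y3.
have nz4 : (Q * Q) ^+ 2 - 1 != 0.
  by rewrite -expr2 -exprM -rmorphXn -(rmorph1 iota) -rmorphB fmorph_eq0 subr_eq0.
have nz5 : Q * Q - 1 != 0.
  by rewrite -expr2 -rmorphXn -(rmorph1 iota) -rmorphB fmorph_eq0 subr_eq0 q2_neq1.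
by field; rewrite ?nzQ ?nz4 ?nz5.
Qed.

Lemma aw_eigvecA y :
  aw_scaled q opA opB opC (eigvec y) = eigvec (fun m => alpha_val * y m).
Proof.
by apply: (aw_eigvec (Y1 := seqA) (Y2 := seqB) (Y3 := seqC)) => *;
  first [exact: opA_eigvec|exact: opB_eigvec|exact: opC_eigvec|exact: seq_awA].
Qed.

Lemma aw_eigvecB y :
  aw_scaled q opB opC opA (eigvec y) = eigvec (fun m => beta_val * y m).
Proof.
by apply: (aw_eigvec (Y1 := seqB) (Y2 := seqC) (Y3 := seqA)) => *;
  first [exact: opA_eigvec|exact: opB_eigvec|exact: opC_eigvec|exact: seq_awB].
Qed.

Lemma aw_eigvecC y :
  aw_scaled q opC opA opB (eigvec y) = eigvec (fun m => gamma_val * y m).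
Proof.
by apply: (aw_eigvec (Y1 := seqC) (Y2 := seqA) (Y3 := seqB)) => *;
  first [exact: opA_eigvec|exact: opB_eigvec|exact: opC_eigvec|exact: seq_awC].
Qed.

Lemma casimir_eigvec y :
  casimir q opA opB opC (eigvec y) = eigvec (fun m => casimir_val * y m).
Proof.
apply: funext => m; apply: funext => b.
rewrite /casimir eigvecE -seq_casimir //.
(* The six operators are made opaque, lest alpha, beta, gamma be unfolded. *)
have hA y' : opA (eigvec y') = eigvec (seqA y') by exact: opA_eigvec.
have hB y' : opB (eigvec y') = eigvec (seqB y') by exact: opB_eigvec.
have hC y' : opC (eigvec y') = eigvec (seqC y') by exact: opC_eigvec.
move: (aw_eigvecA y) (aw_eigvecB y) (aw_eigvecC y).
move: (aw_scaled q opA opB opC) (aw_scaled q opB opC opA) (aw_scaled q opC opA opB).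
move=> Z1 Z2 Z3 e1 e2 e3; move: opA opB opC hA hB hC => X1 X2 X3 hA hB hC.
rewrite !(op_funD, op_funN, op_funZ) !op_funM e1 e2 e3.
rewrite !(hA, hB, hC) !eigvecE !(fmorphV, rmorphXn) /=.
by ring.
Qed.

(** B and C raise the largest index of a sequence by 1, and A fixes it. *)
Definition leads_at (d : nat) (c : K) (y : int -> K) : Prop :=
  y d = c /\ forall m, d%:Z < m -> y m = 0.

Lemma leads_at_seqA d c y : leads_at d c y -> leads_at d (theta d * c) (seqA y).
Proof. by move=> [yd y0]; split=> [|m lt_m]; rewrite /seqA ?yd ?y0 ?mulr0. Qed.

Lemma leads_at_seqB d c y : leads_at d c y -> leads_at d.+1 c (seqB y).
Proof.
move=> [yd y0]; rewrite /seqB; split=> [|m lt_m]; last first.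
  by rewrite !y0 ?mulr0 ?addr0 //; lia.
rewrite (_ : d.+1%:Z - 1 = d%:Z) ?yd; last by lia.
by rewrite !(y0 _) ?mulr0 ?addr0 //; lia.
Qed.

Lemma leads_at_seqC d c y : leads_at d c y -> leads_at d.+1 (- (mu d)^-1 * c) (seqC y).
Proof.
move=> [yd y0]; rewrite /seqC; split=> [|m lt_m]; last first.
  by rewrite !y0 ?mulr0 ?subr0 ?addr0 //; lia.
rewrite (_ : d.+1%:Z - 1 = d%:Z) ?yd; last by lia.
by rewrite !(y0 _) ?mulr0 ?subr0 ?addr0 //; lia.
Qed.

Lemma chain_rep_psi (psi : {lrmorphism Delta q -> Hhat q_neq0}) :
    psi (Agen q) = tgen q_neq0 1 * tgen q_neq0 0 + tVgen q_neq0 0 * tVgen q_neq0 1 ->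
    psi (Bgen q) = tgen q_neq0 3 * tgen q_neq0 0 + tVgen q_neq0 0 * tVgen q_neq0 3 ->
    psi (Cgen q) = tgen q_neq0 2 * tgen q_neq0 0 + tVgen q_neq0 0 * tVgen q_neq0 2 ->
  exists f : {lrmorphism Delta q -> op},
    [/\ f (Agen q) = opA, f (Bgen q) = opB, f (Cgen q) = opC
      & forall x, psi x = 0 -> f x = 0].
Proof.
move=> psiA psiB psiC; have [rho [rho_t rho_tV]] := chain_rep.
exists (rho \o psi : {lrmorphism Delta q -> op}).
by split=> [|||x /= ->]; rewrite ?rmorph0 //= ?psiA ?psiB ?psiC
  rmorphD !rmorphM /= !rho_t !rho_tV.
Qed.

Variable f : {lrmorphism Delta q -> op}.
Hypotheses (fA : f (Agen q) = opA) (fB : f (Bgen q) = opB) (fC : f (Cgen q) = opC).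

Lemma aw_scaled_image x y z : f (aw_scaled q x y z) = aw_scaled q (f x) (f y) (f z).
Proof. by rewrite /aw_scaled linearZ /= lrmorph_aw_elt. Qed.

Lemma casimir_image : f (casimir q (Agen q) (Bgen q) (Cgen q)) = casimir q opA opB opC.
Proof.
rewrite -fA -fB -fC /casimir -!aw_scaled_image.
move: (aw_scaled q _ _ _) (aw_scaled q _ _ _) (aw_scaled q _ _ _) => z1 z2 z3.
move: (Agen q) (Bgen q) (Cgen q) => x1 x2 x3.
have fZ c x : f (c *: x) = c *: f x by rewrite linearZ.
by rewrite !(rmorphB, rmorphD) /= !fZ !rmorphM.
Qed.

Lemma op_expS (X : op) n v : (X ^+ n.+1) v = X ((X ^+ n) v).
Proof. by rewrite exprS. Qed.

Lemma scalar_exp (X : op) c : (forall y, X (eigvec y) = eigvec (fun m => c * y m)) ->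
  forall n y, (X ^+ n) (eigvec y) = eigvec (fun m => c ^+ n * y m).
Proof.
move=> hX; elim=> [|n IHn] y.
  by rewrite expr0 op_fun1; congr eigvec; apply: funext => m; rewrite mul1r.
by rewrite op_expS IHn hX; congr eigvec; apply: funext => m; rewrite exprS mulrA.
Qed.

(** The entry at j + k of the image of the indicator of 0: C acts first, climbing
    from 0 to k, then B climbs to j + k, where A acts by [theta]. *)
Definition top_coef (e : exponents) : K :=
  let: (i, j, k, (l, r, s, t)) := e in
  theta (j + k)%N ^+ i * (\prod_(0 <= n < k) - (mu n%:Z)^-1) *
  (casimir_val ^+ l * alpha_val ^+ r * beta_val ^+ s * gamma_val ^+ t).

Lemma leads_at_monomial i j n z :
  exists2 y, f (monomial q (Agen q) (Bgen q) (Cgen q) (i, j, n, z))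
               (eigvec (fun m => (m == 0)%:R)) = eigvec y
           & leads_at (j + n) (top_coef (i, j, n, z)) y.
Proof.
case: z => [[[l r] s] t]; rewrite /monomial /central_monomial /=.
rewrite !rmorphM !rmorphXn /= !aw_scaled_image casimir_image fA fB fC.
rewrite (scalar_exp aw_eigvecC) (scalar_exp aw_eigvecB) (scalar_exp aw_eigvecA).
rewrite (scalar_exp casimir_eigvec).
set y0 := (X in eigvec X).
set c := casimir_val ^+ l * alpha_val ^+ r * beta_val ^+ s * gamma_val ^+ t.
have top0 : leads_at 0 c y0.
  by split=> [|m m_gt0]; rewrite /y0 /c ?eqxx ?mulr1 ?mulrA // gt_eqF // !mulr0.
have [y1 -> top1] : exists2 y, (opC ^+ n) (eigvec y0) = eigvec y &
    leads_at n ((\prod_(0 <= n0 < n) - (mu n0%:Z)^-1) * c) y.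
  elim: n => [|n [y yE ytop]]; first by exists y0; rewrite // big_geq // mul1r.
  exists (seqC y); first by rewrite op_expS yE opC_eigvec.
  by rewrite big_nat_recr //= [_ * - _]mulrC -mulrA; apply: leads_at_seqC.
set c1 := _ * c in top1.
have [y2 -> top2] : exists2 y, (opB ^+ j) (eigvec y1) = eigvec y & leads_at (j + n) c1 y.
  elim: j => [|j [y yE ytop]]; first by exists y1.
  by exists (seqB y); [rewrite op_expS yE opB_eigvec|exact: leads_at_seqB].
have [y3 -> top3] : exists2 y, (opA ^+ i) (eigvec y2) = eigvec y &
    leads_at (j + n) (theta (j + n)%N ^+ i * c1) y.
  elim: i => [|i [y yE ytop]]; first by exists y2; rewrite // mul1r.
  exists (seqA y); first by rewrite op_expS yE opA_eigvec.
  by rewrite exprS -mulrA; exact: leads_at_seqA.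
by exists y3; rewrite // -mulrA.
Qed.

(** [e.1.1.2 + e.1.2] is j + k. *)
Lemma top_coef_sum (S : seq exponents) (c : exponents -> F) d :
    (forall e, e \in S -> (e.1.1.2 + e.1.2 <= d)%N) ->
    f (\sum_(e <- S) c e *: monomial q (Agen q) (Bgen q) (Cgen q) e) = 0 ->
  \sum_(e <- S) (if (e.1.1.2 + e.1.2 == d)%N then iota (c e) * top_coef e else 0) = 0.
Proof.
move=> le_d; rewrite raddf_sum /=.
move/(congr1 (fun g : op => g (eigvec (fun m => (m == 0)%:R)) d true)).
have -> : (0 : op) (eigvec (fun m => (m == 0)%:R)) d true = 0 by [].
move=> sum0; rewrite -[RHS]sum0 {sum0}.
elim: S le_d => [|e S IHS] le_d; first by rewrite !big_nil.
rewrite !big_cons op_funD IHS; last by move=> e' e'S; apply: le_d; rewrite inE e'S orbT.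
congr (_ + _); rewrite linearZ op_funZ.
have := le_d e (mem_head _ _); case: e {le_d} => [[[i j] n] z] /= le_d.
have [y -> [ytop y0]] := leads_at_monomial i j n z.
rewrite /eigvec; case: eqP => [<-|ne]; first by rewrite ytop.
by rewrite y0 ?mulr0 //; lia.
Qed.

End ChainModule.

(** * Reading exponents off the order of a pole *)

Section Degree.
Variable N : nat.

(** With u, T_1, T_3, T_2 of order N^3, 1, N, N^2, the values of alpha, beta,
    gamma and Omega have orders N^3 + 1, N^3 + N, N^3 + N^2 and 2 N^3. *)
Definition central_order (e : nat * nat * nat * nat) : nat :=
  let: (l, r, s, t) := e in
  (N ^ 3 * (2 * l + r + s + t) + (r + N * (s + N * t)))%N.

(** Larger than every [central_order] of exponents below N, so that the
    contribution of a and that of the central part can be separated. *)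
Definition a_order : nat := (5 * N ^ 4)%N.

Definition digits_small (e : exponents) : Prop :=
  let: (i, j, k, (l, r, s, t)) := e in
  [/\ (l < N)%N, (r < N)%N, (s < N)%N & (t < N)%N].

(** Both signs of the exponent of a are needed: [lam + 1/lam] has order [a_order]
    for either, while the coefficient 1/a of C has a pole for one and a zero for
    the other. *)
Definition pole_order (b : bool) (e : exponents) : int :=
  let: (i, j, k, z) := e in
  a_order%:Z * (i%:Z + (if b then k%:Z else - k%:Z)) + (central_order z)%:Z.

Lemma digit_inj M x x' y y' : (x < M)%N -> (x' < M)%N ->
  (x + M * y = x' + M * y')%N -> x = x' /\ y = y'.
Proof.
move=> lt_x lt_x' e; have M0 : (0 < M)%N by apply: leq_ltn_trans lt_x.
have ey : y = y'.
  have := congr1 (fun z => z %/ M)%N e.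
  by rewrite /= !(addnC _ (M * _)%N) !(mulnC M) !divnMDl // !divn_small // !addn0.
by move: e; rewrite ey => /addIn ->.
Qed.

Lemma digits_lt r s t : (r < N)%N -> (s < N)%N -> (t < N)%N ->
  (r + N * (s + N * t) < N ^ 3)%N.
Proof. by move=> *; rewrite !expnS expn0; nia. Qed.

Lemma central_order_lt l r s t : (l < N)%N -> (r < N)%N -> (s < N)%N ->
  (t < N)%N -> (central_order (l, r, s, t) < a_order)%N.
Proof.
move=> hl hr hs ht; have := digits_lt hr hs ht.
rewrite /central_order /a_order (expnS N 3) => lt3.
set n3 := (N ^ 3)%N in lt3 *.
have : (n3 * (2 * l + r + s + t) <= n3 * (5 * N - 5))%N by rewrite leq_mul2l; lia.
nia.
Qed.

Lemma central_order_inj l r s t l' r' s' t' :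
    (r < N)%N -> (s < N)%N -> (t < N)%N -> (r' < N)%N -> (s' < N)%N -> (t' < N)%N ->
    central_order (l, r, s, t) = central_order (l', r', s', t') ->
  (l, r, s, t) = (l', r', s', t').
Proof.
move=> hr hs ht hr' hs' ht'.
rewrite /central_order !(addnC (N ^ 3 * _)%N) => e.
have [e1 e2] := digit_inj (digits_lt hr hs ht) (digits_lt hr' hs' ht') e.
have [-> e3] := digit_inj hr hr' e1; have [-> e4] := digit_inj hs hs' e3.
by rewrite e4 in e2 *; congr (_, _, _, _); lia.
Qed.

Lemma pole_order_inj b i j k z i' j' k' z' :
    digits_small (i, j, k, z) -> digits_small (i', j', k', z') ->
    pole_order b (i, j, k, z) = pole_order b (i', j', k', z') ->
  (if b then (i + k = i' + k')%N else (i + k' = i' + k)%N) /\ z = z'.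
Proof.
case: z z' => [[[l r] s] t] [[[l' r'] s'] t'] [hl hr hs ht] [hl' hr' hs' ht'].
rewrite /pole_order.
have := central_order_lt hl hr hs ht; have := central_order_lt hl' hr' hs' ht'.
have := @central_order_inj l r s t l' r' s' t' hr hs ht hr' hs' ht'.
set c := central_order _; set c' := central_order _; set E := a_order.
move=> cinj lt_c' lt_c.
set x := i%:Z + _; set x' := i'%:Z + _ => e.
have ex : x = x'.
  have [lt_x|lt_x|//] := ltgtP x x'; exfalso.
    have : E%:Z * (x + 1) <= E%:Z * x' by rewrite ler_wpM2l //; lia.
    by lia.
  have : E%:Z * (x' + 1) <= E%:Z * x by rewrite ler_wpM2l //; lia.
  by lia.
split; last by apply: cinj; move: e; rewrite ex => /addrI [].
by move: ex; rewrite /x /x'; case: b {x x' e}; lia.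
Qed.

Lemma pole_order_lt b i j k z i' j' k' z' :
    digits_small (i, j, k, z) -> digits_small (i', j', k', z') ->
    (if b then (i + k < i' + k')%N else (i + k' < i' + k)%N) ->
  pole_order b (i, j, k, z) < pole_order b (i', j', k', z').
Proof.
case: z z' => [[[l r] s] t] [[[l' r'] s'] t'] [hl hr hs ht] [hl' hr' hs' ht'].
rewrite /pole_order => h; have := central_order_lt hl hr hs ht.
set c := central_order _; set c' := central_order _; set E := a_order.
set x := i%:Z + _; set x' := i'%:Z + _ => lt_c.
have lt_x : x + 1 <= x' by rewrite /x /x'; case: b h {x x'}; lia.
have : E%:Z * (x + 1) <= E%:Z * x' by rewrite ler_wpM2l //; lia.
by lia.
Qed.

(** Since i j k = 0 and j + k = d, the exponents of A, B, C form one of the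
    families (i, d, 0), (i, 0, d) and (0, d - k, k).  If some (i0, d, 0) satisfies
    i0 > i - k for all terms with k > 0, the order built from i - k is
    largest only at terms with k = 0, which it tells apart.  Otherwise every
    (i, d, 0) is beaten, for i + k, by some term with k > 0, and among those
    i + k determines (i, k). *)
Lemma top_order_unique d (S : seq exponents) :
    (forall i j k z, (i, j, k, z) \in S ->
       [/\ normal (i, j, k, z), digits_small (i, j, k, z) & (j + k = d)%N]) ->
  exists b, forall e e', e \in S -> e' \in S ->
    (forall e1, e1 \in S -> pole_order b e1 <= pole_order b e) ->
    pole_order b e = pole_order b e' -> e = e'.
Proof.
move=> HS.
have [[i0 [z0 [S0 i0_max]]]|no_dom] := pselect (exists i0 z0,
   (i0, d, 0%N, z0) \in S /\
   forall i j k z, (i, j, k, z) \in S -> (0 < k)%N -> (i < i0 + k)%N).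
  exists false => -[[[i j] k] z] [[[i' j'] k'] z'] Se Se' emax ee'.
  have [_ sm0 _] := HS _ _ _ _ S0.
  have k0 i1 j1 k1 z1 : (i1, j1, k1, z1) \in S ->
      pole_order false (i1, j1, k1, z1) = pole_order false (i, j, k, z) -> k1 = 0%N.
    move=> S1 e1; have [_ sm1 _] := HS _ _ _ _ S1.
    case: (posnP k1) => // k1_gt0; have := emax _ S0; rewrite -e1 leNgt.
    by rewrite pole_order_lt // addn0; apply: i0_max S1 k1_gt0.
  have [_ sm dE] := HS _ _ _ _ Se; have [_ sm' dE'] := HS _ _ _ _ Se'.
  have [ik ->] := pole_order_inj sm sm' ee'.
  have kE := k0 _ _ _ _ Se erefl; have k'E := k0 _ _ _ _ Se' (esym ee').
  by congr (_, _, _, _); lia.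
exists true => -[[[i j] k] z] [[[i' j'] k'] z'] Se Se' emax ee'.
have k_gt0 i1 j1 k1 z1 : (i1, j1, k1, z1) \in S ->
    pole_order true (i1, j1, k1, z1) = pole_order true (i, j, k, z) ->
    ((0 < k1) || (d == 0))%N.
  move=> S1 e1; have [_ sm1 d1] := HS _ _ _ _ S1.
  case: (posnP k1) => // k1_0 /=; apply: contra_notT no_dom => d_gt0.
  exists i1, z1; split; first by move: S1; rewrite k1_0 (_ : j1 = d) //; lia.
  move=> i2 j2 k2 z2 S2 k2_gt0; have [n2 sm2 d2] := HS _ _ _ _ S2.
  rewrite ltnNge; apply/negP => le_i; have := emax _ S2; rewrite -e1 leNgt.
  by rewrite pole_order_lt //= k1_0; lia.
have [n sm dE] := HS _ _ _ _ Se; have [n' sm' dE'] := HS _ _ _ _ Se'.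
have [ik ->] := pole_order_inj sm sm' ee'.
have kE := k_gt0 _ _ _ _ Se erefl; have k'E := k_gt0 _ _ _ _ Se' (esym ee').
by move: n n' ik; rewrite /normal /= => n n' ik; congr (_, _, _, _); lia.
Qed.
End Degree.

(** * Leading coefficients in a field of rational functions *)

Section Leading.
Variable F : fieldType.

Definition ratfun : fieldType := {fraction {poly F}}.
Definition ratfun_poly : {rmorphism {poly F} -> ratfun} := @tofrac {poly F}.
Definition ratfunC : {rmorphism F -> ratfun} := ratfun_poly \o polyC.
Definition ratfunX : ratfun := ratfun_poly 'X.

(** f has at most a pole of order n at X = 0, with c the coefficient of X^-n;
    restricting to Laurent polynomials is enough. *)
Definition leading (n : int) (c : F) (f : ratfun) : Prop :=
  exists P : {poly F}, f * ratfunX ^ n = ratfun_poly P /\ P`_0 = c.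

Lemma ratfun_poly_inj : injective ratfun_poly.
Proof. by move=> P R /eqP; rewrite tofrac_eq => /eqP. Qed.

Lemma ratfunX_neq0 : ratfunX != 0.
Proof. by rewrite -(rmorph0 ratfun_poly) (inj_eq ratfun_poly_inj) polyX_eq0. Qed.

Lemma leading_unique n c d f : leading n c f -> leading n d f -> c = d.
Proof. by move=> [P [fP <-]] [R [+ <-]]; rewrite fP => /ratfun_poly_inj ->. Qed.

Lemma leading0 n : leading n 0 0.
Proof. by exists 0; rewrite mul0r rmorph0 coef0. Qed.

Lemma leadingC c : leading 0 c (ratfunC c).
Proof. by exists c%:P; rewrite mulr1 coefC. Qed.

Lemma leadingD n c d f g : leading n c f -> leading n d g ->
  leading n (c + d) (f + g).
Proof.
by move=> [P [fP <-]] [R [gR <-]]; exists (P + R); rewrite mulrDl fP gR rmorphD coefD.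
Qed.

Lemma leadingM m n c d f g : leading m c f -> leading n d g ->
  leading (m + n) (c * d) (f * g).
Proof.
move=> [P [fP <-]] [R [gR <-]]; exists (P * R).
by rewrite expfzDr ?ratfunX_neq0 // mulrACA fP gR rmorphM coef0M.
Qed.

Lemma leadingN n c f : leading n c f -> leading n (- c) (- f).
Proof. by move=> [P [fP <-]]; exists (- P); rewrite mulNr fP rmorphN coefN. Qed.

Lemma leading_lt m n c f : m < n -> leading m c f -> leading n 0 f.
Proof.
move=> lt_mn [P [fP _]]; have [d ->] : exists d, n = m + d.+1%:Z.
  by exists (absz (n - m)).-1; lia.
exists (P * 'X ^+ d.+1); split; last by rewrite coef0M coefXn mulr0.
by rewrite expfzDr ?ratfunX_neq0 // mulrA fP rmorphM rmorphXn.
Qed.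

Lemma leading1 : leading 0 1 1.
Proof. by exists 1; rewrite mulr1 rmorph1 coefC. Qed.

Lemma leadingX n c f i : leading n c f -> leading (n * i%:Z) (c ^+ i) (f ^+ i).
Proof.
move=> lf; elim: i => [|i IHi]; first by rewrite mulr0; apply: leading1.
by rewrite !exprS -addn1 PoszD mulrDr mulr1 addrC; apply: leadingM.
Qed.

Lemma leading_sum n (I : eqType) (s : seq I) (c : I -> F) (f : I -> ratfun) :
    (forall i, i \in s -> leading n (c i) (f i)) ->
  leading n (\sum_(i <- s) c i) (\sum_(i <- s) f i).
Proof.
elim: s => [|i s IHs] h; first by rewrite !big_nil; apply: leading0.
rewrite !big_cons; apply: leadingD; first by apply: h; rewrite mem_head.
by apply: IHs => j js; apply: h; rewrite inE js orbT.
Qed.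

Lemma leading_ratfunX n : leading (- n) 1 (ratfunX ^ n).
Proof.
by exists 1; rewrite -expfzDr ?ratfunX_neq0 // subrr rmorph1 coefC.
Qed.

Lemma leadingCX c (z : int) : leading 0 (c ^ z) (ratfunC c ^ z).
Proof. by rewrite -fmorphXz; apply: leadingC. Qed.
End Leading.

Lemma seq_argmax (I : eqType) d (T : orderType d) (g : I -> T) (s : seq I) x0 :
  x0 \in s -> exists2 x, x \in s & forall y, y \in s -> (g y <= g x)%O.
Proof.
elim: s x0 => // x s IHs x0 _.
case: s IHs => [|x1 s] IHs; first by exists x; rewrite ?mem_head // => y /[!inE]/eqP->.
have [y ys ymax] := IHs x1 (mem_head _ _).
have [le_xy|lt_yx] := leP (g x) (g y).
  by exists y => [|z]; rewrite inE ?ys ?orbT // => /orP[/eqP->|/ymax].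
exists x => [|z]; first exact: mem_head.
by rewrite inE => /orP[/eqP->//|/ymax/le_trans]; apply; exact: ltW.
Qed.

(** * Specialization of the parameters *)

Section Specialization.
Variables (F : fieldType) (q : F) (N : nat) (b : bool).
Hypotheses (q_neq0 : q != 0) (N_gt1 : (1 < N)%N).
Local Notation K := (ratfun F).
Local Notation iota := (ratfunC F).
Local Notation X := (ratfunX F).
Local Notation Q := (iota q).
Let E : int := a_order N.
Let e : int := if b then - E else E.

Definition par_a : K := X ^ (- e).
Definition par_k : K := X ^ (- (N ^ 3)%N%:Z).
Definition par_T1 : K := X ^ (- 1).
Definition par_T2 : K := X ^ (- (N ^ 2)%N%:Z).
Definition par_T3 : K := X ^ (- N%:Z).

Local Notation u := (u_val iota q par_k).
Local Notation al := (alpha_val iota q par_k par_T1 par_T2 par_T3).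
Local Notation be := (beta_val iota q par_k par_T1 par_T2 par_T3).
Local Notation ga := (gamma_val iota q par_k par_T1 par_T2 par_T3).
Local Notation om := (casimir_val iota q par_k par_T1 par_T2 par_T3).
Local Notation n3 := ((N ^ 3)%N%:Z).

Lemma par_a_neq0 : par_a != 0. Proof. by rewrite expfz_neq0 ?ratfunX_neq0. Qed.
Lemma par_k_neq0 : par_k != 0. Proof. by rewrite expfz_neq0 ?ratfunX_neq0. Qed.

Lemma leading_a : leading e 1 par_a.
Proof. by rewrite -[e]opprK; apply: leading_ratfunX. Qed.

Lemma par_E_gt0 : 0 < E.
Proof. by rewrite /E /a_order; have : (0 < N ^ 4)%N; [rewrite expn_gt0 ltnW|lia]. Qed.

(** The square of a q^n has a nonzero order, so it is not 1. *)
Lemma par_a_generic (n : int) : (par_a * Q ^ n) ^+ 2 != 1.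
Proof.
apply/eqP => h.
have la : leading (e * 2) ((1 * q ^ n) ^+ 2) 1.
  rewrite -h -[e]addr0; apply: (@leadingX _ _ _ _ 2).
  by apply: leadingM; [apply: leading_a|apply: leadingCX].
have l1 : leading 0 (1 : F) (1 : K) by exact: leading1.
have E0 := par_E_gt0.
have [e_gt0|e_lt0|e0] := ltgtP 0 e; last by rewrite /e in e0; case: b e0; lia.
  have lt_e : 0 < e * 2 by lia.
  have /eqP := leading_unique (leading_lt lt_e l1) la.
  by rewrite eq_sym mul1r expf_eq0 /= expfz_eq0 (negPf q_neq0) andbF.
have lt_e : e * 2 < 0 by lia.
have /eqP := leading_unique (leading_lt lt_e la) l1.
by rewrite eq_sym oner_eq0.
Qed.

Lemma leading_lam m : leading e (q ^ (- (2 * m))) (lam iota q par_a m).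
Proof.
by rewrite -[e]addr0 -[q ^ _]mul1r; apply: leadingM; [apply: leading_a|apply: leadingCX].
Qed.

Lemma lam_inv m : (lam iota q par_a m)^-1 = X ^ e * Q ^ (2 * m).
Proof. by rewrite /lam invfM /par_a !invr_expz !opprK. Qed.

Lemma leading_lamV m : leading (- e) (q ^ (2 * m)) (lam iota q par_a m)^-1.
Proof.
rewrite lam_inv -[- e]addr0 -[q ^ _]mul1r; apply: leadingM; last exact: leadingCX.
exact: leading_ratfunX.
Qed.

Lemma leading_theta m : exists2 c, c != 0 & leading E c (theta iota q par_a m).
Proof.
have := leading_lam m; have := leading_lamV m; rewrite /theta.
have E0 := par_E_gt0; rewrite /e; case: b; rewrite ?opprK => lV l.
  exists (q ^ (2 * m)); first by rewrite expfz_neq0.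
  by rewrite -[q ^ _]add0r; apply: leadingD => //; apply: leading_lt l; lia.
exists (q ^ (- (2 * m))); first by rewrite expfz_neq0.
by rewrite -[q ^ _]addr0; apply: leadingD => //; apply: leading_lt lV; lia.
Qed.

Lemma leading_muV m : exists2 c, c != 0 & leading (- e) c (- (mu iota q par_a m)^-1).
Proof.
exists (- (q ^ (2 * m) * q)); first by rewrite oppr_eq0 mulf_neq0 ?expfz_neq0.
rewrite /mu invfM invrK; apply: leadingN; rewrite -[- e]addr0.
by apply: leadingM; [apply: leading_lamV|apply: leadingC].
Qed.

Lemma leading_u : leading n3 q^-1 u.
Proof.
rewrite /u_val -[q^-1]addr0; apply: leadingD.
  rewrite -[q^-1]mul1r -[X in leading X]addr0; apply: leadingM.
    by rewrite -[X in leading X]opprK; apply: leading_ratfunX.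
  by rewrite -fmorphV; apply: leadingC.
apply: (@leading_lt _ (- n3) _ (q * 1)).
  by have : (0 < N ^ 3)%N; [rewrite expn_gt0 ltnW|lia].
rewrite -[X in leading X]add0r; apply: leadingM; first exact: leadingC.
by rewrite /par_k invr_expz opprK; apply: leading_ratfunX.
Qed.

Lemma leading_ratfunXN n : leading n 1 (X ^ (- n)).
Proof. by rewrite -{1}[n]opprK; apply: leading_ratfunX. Qed.

(* Makes the products u T_i dominate T_j T_l, and u^2 dominate u T_1 T_2 T_3. *)
Let N3 : (N ^ 3 > 1 + N + N ^ 2)%N.
Proof. by rewrite !expnS expn0; nia. Qed.

Lemma leading_mix (x y z : int) : y + z < n3 + x ->
  leading (n3 + x) q^-1 (X ^ (- x) * u + X ^ (- y) * X ^ (- z)).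
Proof.
move=> lt_x; rewrite -[q^-1]addr0; apply: leadingD.
  rewrite addrC -[q^-1]mul1r; apply: leadingM leading_u; exact: leading_ratfunXN.
by apply: leading_lt lt_x _; apply: leadingM; apply: leading_ratfunXN.
Qed.

Lemma leading_alpha : leading (n3 + 1) q^-1 al.
Proof. by apply: leading_mix; lia. Qed.
Lemma leading_beta : leading (n3 + N%:Z) q^-1 be.
Proof. by apply: leading_mix; lia. Qed.
Lemma leading_gamma : leading (n3 + (N ^ 2)%N%:Z) q^-1 ga.
Proof. by apply: leading_mix; lia. Qed.

Lemma leading_casimir : leading (n3 * 2) (- (q^-1) ^+ 2) om.
Proof.
have lY2 n : n < n3 -> leading (n3 * 2) 0 (- (X ^ (- n)) ^+ 2).
  move=> lt_n; rewrite -oppr0; apply: leadingN.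
  by apply: leading_lt (leadingX 2 (leading_ratfunXN n)); lia.
rewrite /casimir_val.
have -> : - (q^-1) ^+ 2 = 0 + - (q^-1) ^+ 2 + 0 + 0 + 0 + - 0.
  by rewrite add0r oppr0 !addr0.
apply: leadingD; last first.
  apply: leadingN.
  have lX := leading_ratfunXN.
  have := leadingM (leadingM (leadingM leading_u (lX 1)) (lX (N ^ 2)%N)) (lX N).
  by apply: leading_lt; lia.
apply: leadingD; last by apply: lY2; lia.
apply: leadingD; last by apply: lY2; lia.
apply: leadingD; last by apply: lY2; lia.
apply: leadingD; last by apply: leadingN; apply: (leadingX 2 leading_u).
apply: (@leading_lt _ 0 _ ((q + q^-1) ^+ 2)); first by lia.
by rewrite -fmorphV -rmorphD -rmorphXn; apply: leadingC.
Qed.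

Lemma leading_top_coef z : exists2 c, c != 0 &
  leading (pole_order N b z) c
    (top_coef iota q par_a par_k par_T1 par_T2 par_T3 z).
Proof.
case: z => [[[i j] k] [[[l r] s] t]].
have [cA cA0 lA] := leading_theta (j + k)%N.
have [cC cC0 lC] : exists2 c, c != 0 &
    leading (- e * k) c
      (\prod_(0 <= n < k) - (mu iota q par_a n%:Z)^-1).
  elim: k {cA cA0 lA} => [|k [c c0 lc]].
    by exists 1; rewrite ?oner_eq0 // big_geq // mulr0; apply: leading1.
  have [c' c'0 lc'] := leading_muV k.
  exists (c * c'); first by rewrite mulf_neq0.
  rewrite big_nat_recr //= -addn1 PoszD mulrDr mulr1.
  exact: leadingM.
have lo := leadingX l leading_casimir.
have la := leadingX r leading_alpha.
have lb := leadingX s leading_beta.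
have lg := leadingX t leading_gamma.
exists (cA ^+ i * cC * ((- q^-1 ^+ 2) ^+ l * q^-1 ^+ r * q^-1 ^+ s * q^-1 ^+ t)).
  by rewrite !mulf_neq0 ?expf_neq0 ?oppr_eq0 ?expf_neq0 ?invr_eq0.
have lz := leadingM (leadingM (leadingM lo la) lb) lg.
have := leadingM (leadingM (leadingX i lA) lC) lz.
congr leading; rewrite /pole_order /central_order /e /E !(PoszD, PoszM).
by case: (b); ring.
Qed.
End Specialization.

(** * Injectivity *)

Lemma psi_kernel (F : fieldType) (q : F)
    (q_neq0 : q != 0) (q4_neq1 : q ^+ 4 != 1)
    (psi : {lrmorphism Delta q -> Hhat q_neq0})
    (psiA : psi (Agen q) =
       tgen q_neq0 1 * tgen q_neq0 0 + tVgen q_neq0 0 * tVgen q_neq0 1)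
    (psiB : psi (Bgen q) =
       tgen q_neq0 3 * tgen q_neq0 0 + tVgen q_neq0 0 * tVgen q_neq0 3)
    (psiC : psi (Cgen q) =
       tgen q_neq0 2 * tgen q_neq0 0 + tVgen q_neq0 0 * tVgen q_neq0 2) x :
  psi x = 0 -> x = 0.
Proof.
have [S [c [uS nS cS ->]]] := Delta_normal_form q_neq0 q4_neq1 x.
case: S uS nS cS => [|e0 S0]; first by rewrite big_nil.
set S := e0 :: S0 => uS nS cS psi0; exfalso.
(* N exceeds every central exponent, and 1 as the orders require. *)
pose size_e (e : exponents) : nat :=
  let: (i, j, k, (l, r, s, t)) := e in (l + r + s + t)%N.
pose N := (\max_(e <- S) size_e e).+2.
have N_gt1 : (1 < N)%N by [].
have smallS e : e \in S -> digits_small N e.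
  move=> eS; have : (size_e e <= \max_(e <- S) size_e e)%N by apply: leq_bigmax_seq.
  by case: e eS => [[[i j] k] [[[l r] s] t]] _; rewrite /digits_small /N /=; split; lia.
pose lvl (e : exponents) : nat := (e.1.1.2 + e.1.2)%N.
have [e1 e1S le_d] := seq_argmax lvl (mem_head e0 S0).
pose d := lvl e1.
pose S1 := [seq e <- S | lvl e == d].
(* The sign b is chosen before the module, whose parameter a depends on it. *)
have [|b bmax] := @top_order_unique N d S1.
  move=> i j k z; rewrite mem_filter => /andP[/eqP lv eS].
  by split; [exact: nS|exact: smallS|].
have [e eS1 emax] : exists2 e, e \in S1 &
    forall e', e' \in S1 -> pole_order N b e' <= pole_order N b e.
  by apply: (@seq_argmax _ _ _ _ _ e1); rewrite mem_filter eqxx.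
have [f [fA fB fC f0]] := chain_rep_psi (par_k F N) (par_T1 F) (par_T2 F N)
  (par_T3 F N) (par_a_neq0 F N b) (par_a_generic b q_neq0 N_gt1) psiA psiB psiC.
have sum0 := top_coef_sum q_neq0 q4_neq1 (par_a_neq0 F N b) (par_k_neq0 F N)
  (par_a_generic b q_neq0 N_gt1) fA fB fC (S := S) (c := c) le_d (f0 _ psi0).
have [ce ce0 le_e] := leading_top_coef b q_neq0 N_gt1 e.
have eS : e \in S by move: eS1; rewrite mem_filter => /andP[].
(* At the largest order only e contributes to the vanishing entry at d. *)
have : leading (pole_order N b e) (\sum_(e' <- S) (if e' == e then c e' * ce else 0)) 0.
  rewrite -sum0; apply: leading_sum => e' e'S.
  rewrite -[(_ + _)%N]/(lvl e'); have [lv|ne_lv] := eqVneq (lvl e') d; last first.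
    have [ee'|_] := eqVneq e' e; last exact: leading0.
    by move: ne_lv eS1; rewrite ee' mem_filter => /negPf->.
  have e'S1 : e' \in S1 by rewrite mem_filter e'S andbT; apply/eqP.
  have [->|ne] := eqVneq e' e.
    by rewrite -[pole_order N b e]add0r; apply: leadingM le_e; apply: leadingC.
  have [ce' _ le_e'] := leading_top_coef b q_neq0 N_gt1 e'.
  apply: (@leading_lt _ (pole_order N b e') _ (c e' * ce')).
    rewrite lt_neqAle emax // andbT; apply: contraNneq ne => /esym deq.
    by rewrite (bmax e e').
  by rewrite -[pole_order N b e']add0r; apply: leadingM le_e'; apply: leadingC.
move/leading_unique/(_ (leading0 _ _))/eqP.
rewrite -big_mkcond -big_filter filter_pred1_uniq // big_seq1.
by rewrite mulf_eq0 (negPf ce0) orbF (negPf (cS _ eS)).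
Qed.

Theorem theorem4p5 (F : fieldType) (q : F)
    (q_neq0 : q != 0) (q4_neq1 : q ^+ 4 != 1)
    (psi : {lrmorphism Delta q -> Hhat q_neq0})
    (psiA : psi (Agen q) =
       tgen q_neq0 1 * tgen q_neq0 0 + tVgen q_neq0 0 * tVgen q_neq0 1)
    (psiB : psi (Bgen q) =
       tgen q_neq0 3 * tgen q_neq0 0 + tVgen q_neq0 0 * tVgen q_neq0 3)
    (psiC : psi (Cgen q) =
       tgen q_neq0 2 * tgen q_neq0 0 + tVgen q_neq0 0 * tVgen q_neq0 2) :
  injective psi.
Proof.
move=> x y e; apply/eqP; rewrite -subr_eq0; apply/eqP.
by apply: (psi_kernel q4_neq1 psiA psiB psiC); rewrite raddfB /= e subrr.
Qed.
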